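(* Let $(X,\mu,d)$ with Dirichlet form $\mathcal{E}$ be a local Dirichlet space satisfying all the standing assumptions listed in the context (the volume estimates (V1) and (V2), and the two-sided heat kernel estimate GE($\beta$) with parameter $1<\beta\le 2$), and let $(X_s)_{s\ge 0}$ be the associated diffusion. For $\epsilon>0$ and $t>0$ let $C_t=\{X_s : 0\le s\le t\}$ be the set of points in the sample path of the diffusion up to time $t$, and let $C_t^{\epsilon}=\bigcup_{z\in C_t}B(z,\epsilon)$ be the union of the balls of radius $\epsilon$ centered at the points of $C_t$. Then for every $\epsilon>0$, every $\nu>0$ and every starting point $x\in X$, $$-\log \mathbb{E}^x\left[\exp\left(-\nu\, \mu\left(C_{t^{\beta}V(x,t)}^{\epsilon}\right)\right)\right] \simeq V(x,t),$$ that is, there exist constants $0<c\le C<\infty$ such that for all sufficiently large $t$, $$c\,V(x,t)\le -\log \mathbb{E}^x\left[\exp\left(-\nu\, \mu\left(C_{t^{\beta}V(x,t)}^{\epsilon}\right)\right)\right]\le C\,V(x,t).$$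
   Context: Setting: $(X,d)$ is a complete (locally compact, separable) metric space with a positive $\sigma$-finite Radon measure $\mu$, and $\mathcal{E}$ is a fixed regular, strongly local, symmetric Dirichlet form with domain $\mathrm{Dom}(\mathcal{E})\subset L^2(X,\mu)$ (real Hilbert space). Such a triple with its form is called a local Dirichlet space. $\Delta$ denotes the associated nonnegative self-adjoint operator on $L^2(X,\mu)$, so that $\mathcal{E}(f,g)=\langle \Delta f,g\rangle=\int_X \Delta f\, g\,d\mu$ for $f\in \mathrm{Dom}(\Delta)$, $g\in\mathrm{Dom}(\mathcal{E})$. The heat kernel $h_t(x,y)$ is the kernel of the semigroup $H_t=e^{-t\Delta}$ with respect to $\mu$ (assumed to exist). $(X_s)_{s\ge0}$ is the diffusion process on $X$ with transition density $h_t(x,y)$ with respect to $\mu$; $\mathbb{P}^x$ and $\mathbb{E}^x$ denote its law and expectation when started from $x\in X$. Notation: $B(x,r)$ is the ball of radius $r$ centered at $x$ and $V(x,r)=\mu(B(x,r))$. Standing assumptions: (V1) There is $c>0$ such that for all $r>0$: $cr<\inf_{x\in X}V(x,r)\le\sup_{x\in X}V(x,r)<\infty$. (V2) For $x\in X$: $\displaystyle\liminf_{r\to\infty}V(x,r)^{-1}\inf_{y\in B(x,\,r^{\beta}V(x,r))}V(y,r)>0$. GE($\beta$): there exist positive constants $c,C$ such that for all $x,y\in X$ and all $t>0$, $$\frac{c}{V(x,t^{1/\beta})}\exp\left(-C\left(\frac{d(x,y)^{\beta}}{t}\right)^{1/(\beta-1)}\right)\le h_t(x,y)\le\frac{C}{V(x,t^{1/\beta})}\exp\left(-c\left(\frac{d(x,y)^{\beta}}{t}\right)^{1/(\beta-1)}\right).$$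 *)

(* Defs.v *)
From HB Require Import structures.
From mathcomp Require Import all_boot all_order all_algebra.
From mathcomp Require Import all_classical all_reals all_analysis.

Set Implicit Arguments.
Unset Strict Implicit.
Unset Printing Implicit Defensive.
Import Order.TTheory GRing.Theory Num.Theory.
Import numFieldNormedType.Exports.
Local Open Scope classical_set_scope.
Local Open Scope ring_scope.

#[short(type="completeMetricType")]
HB.structure Definition CompleteMetric (K : numDomainType) :=
  { M of Metric K M & Complete M }.

Notation borel X := (g_sigma_algebraType (@open X)).

Definition separable (X : topologicalType) :=
  exists2 D : set X, countable D & dense D.

(* Elements of L^2 are represented by functions; the form, its operator and its
   semigroup below are compatible with modification on a null set. *)
Notation L2 mu := (Lfun mu 2%:E).

Section dirichlet.
Context {R : realType} {X : completeMetricType R}.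
Variable mu : {measure set (borel X) -> \bar R}.
Implicit Types (f g v : X -> R) (t : R) (x y : X).

Definition radon :=
  [/\ forall K : set X, compact K -> (mu K < +oo)%E,
      forall A : set (borel X), measurable A ->
        mu A = ereal_inf [set mu U | U in [set U | open U /\ A `<=` U]] &
      forall U : set X, open U ->
        mu U = ereal_sup [set mu K | K in [set K | compact K /\ K `<=` U]]].

Definition norm2 f : \bar R := 'N[mu]_2%:E[EFin \o f]%E.

Definition ip f g : R := \int[mu]_x (f x * g x).

Definition unit_contraction f : X -> R := fun x => Num.min (Num.max (f x) 0) 1.

(* Symmetric Dirichlet forms on L^2(X, mu): densely defined, symmetric,
   nonnegative, closed and Markovian. *)
Record dirichlet_form := DirichletForm {
  dom : set (X -> R) ;
  form :> (X -> R) -> (X -> R) -> R ;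
  dom_L2 : forall f, dom f -> f \in L2 mu ;
  dom_ae : forall f g, dom f -> measurable_fun setT (g : borel X -> R) ->
    f = g %[ae mu] -> dom g ;
  dom_lin : forall (a : R) f g, dom f -> dom g ->
    dom (fun x => a * f x + g x) ;
  dom_dense : forall f, f \in L2 mu -> forall e : R, 0 < e ->
    exists2 g, dom g & (norm2 (f \- g)%R < e%:E)%E ;
  form_ae : forall f g v, dom f -> dom g -> dom v ->
    f = g %[ae mu] -> form f v = form g v ;
  form_lin : forall (a : R) f g v, dom f -> dom g -> dom v ->
    form (fun x => a * f x + g x) v = a * form f v + form g v ;
  form_sym : forall f g, dom f -> dom g -> form f g = form g f ;
  form_ge0 : forall f, dom f -> 0 <= form f f ;
  form_closed : forall u : nat -> X -> R, (forall n, dom (u n)) ->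
    (forall e : R, 0 < e -> exists N, forall m n, (N <= m)%N -> (N <= n)%N ->
       form (u m \- u n) (u m \- u n) + ip (u m \- u n) (u m \- u n) < e) ->
    exists2 v, dom v &
      (form (u n \- v) (u n \- v) + ip (u n \- v) (u n \- v))
        @[n --> \oo] --> (0 : R) ;
  form_markov : forall f, dom f -> dom (unit_contraction f) /\
    form (unit_contraction f) (unit_contraction f) <= form f f
}.

Definition Cc f := continuous f /\ compact (closure [set x | f x != 0]).

Definition regular_form (E : dirichlet_form) :=
  (forall f, dom E f -> forall e : R, 0 < e ->
     exists2 g, dom E g /\ Cc g &
       E (f \- g) (f \- g) + ip (f \- g) (f \- g) < e) /\
  (forall f, Cc f -> forall e : R, 0 < e ->
     exists2 g, dom E g /\ Cc g & forall x, `|f x - g x| < e).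

(* Support of the class of f modulo null sets, i.e. of the measure |f| mu. *)
Definition ae_support f : set X :=
  ~` \bigcup_(U in [set U : set X | open U /\
                      {ae mu, forall x, U x -> f x = 0}]) U.

Definition strongly_local (E : dirichlet_form) :=
  forall f g, dom E f -> dom E g ->
    compact (ae_support f) -> compact (ae_support g) ->
    (exists (U : set X) (c : R), [/\ open U, ae_support g `<=` U &
       {ae mu, forall x, U x -> f x = c}]) ->
    E f g = 0.

(* Graph of the nonnegative self-adjoint operator Delta associated with E:
   f \in Dom(Delta) and Delta f = g. *)
Definition laplacian (E : dirichlet_form) f g :=
  [/\ dom E f, g \in L2 mu & forall v, dom E v -> E f v = ip g v].

(* H_t = exp(- t Delta), as the strongly continuous contraction semigroup on
   L^2(X, mu) whose infinitesimal generator is exactly - Delta. *)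
Record heat_semigroup (E : dirichlet_form) := HeatSemigroup {
  semigroup :> R -> (X -> R) -> (X -> R) ;
  semigroup_L2 : forall t f, 0 <= t -> f \in L2 mu -> semigroup t f \in L2 mu ;
  semigroup_ae : forall t f g, 0 <= t -> f \in L2 mu -> g \in L2 mu ->
    f = g %[ae mu] -> semigroup t f = semigroup t g %[ae mu] ;
  semigroup_lin : forall t (a : R) f g, 0 <= t -> f \in L2 mu -> g \in L2 mu ->
    semigroup t (fun x => a * f x + g x) =
      (fun x => a * semigroup t f x + semigroup t g x) %[ae mu] ;
  semigroup_contraction : forall t f, 0 <= t -> f \in L2 mu ->
    (norm2 (semigroup t f) <= norm2 f)%E ;
  semigroup0 : forall f, f \in L2 mu -> semigroup 0 f = f %[ae mu] ;
  semigroupD : forall s t f, 0 <= s -> 0 <= t -> f \in L2 mu ->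
    semigroup (s + t) f = semigroup s (semigroup t f) %[ae mu] ;
  semigroup_cont : forall f, f \in L2 mu ->
    norm2 (semigroup t f \- f) @[t --> 0^'+] --> (0 : \bar R)%E ;
  semigroup_generator : forall f g, f \in L2 mu -> g \in L2 mu ->
    (laplacian E f g <->
     norm2 (fun x => (f x - semigroup t f x) / t - g x)
       @[t --> 0^'+] --> (0 : \bar R)%E)
}.

Definition heat_kernel (E : dirichlet_form) (H : heat_semigroup E)
    (h : R -> X -> X -> R) :=
  forall t, 0 < t ->
    measurable_fun setT (fun z : borel X * borel X => h t z.1 z.2) /\
    forall f, f \in L2 mu ->
      \forall x \ae mu,
        mu.-integrable setT (fun y : borel X => (h t x y * f y)%:E) /\
        H t f x = \int[mu]_y (h t x y * f y).

(* The paths are X-valued for all times; this loses nothing for the form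
   considered, which is conservative under the heat kernel bounds below.
   Continuity of the paths and the Markov property determine each P^x on the
   events generated by the process. *)
Record diffusion (h : R -> X -> X -> R) d (W : measurableType d) := Diffusion {
  law :> X -> probability W R ;
  traj : R -> W -> X ;
  traj_measurable : forall s : R, 0 <= s ->
    measurable_fun setT (traj s : W -> borel X) ;
  traj_continuous : forall w, {within `[0, +oo[, continuous (traj^~ w)} ;
  traj_start : forall x, law x [set w | traj 0 w = x] = 1%E ;
  traj_markov : forall x (s t : R) (F : set W) (B : set (borel X)),
    0 <= s -> 0 < t ->
    <<s [set G | exists (r : R) (A : set (borel X)),
           [/\ 0 <= r <= s, measurable A & G = traj r @^-1` A]] >> F ->
    measurable B ->
    (law x (F `&` traj (s + t) @^-1` B) =
     \int[law x]_(w in F) \int[mu]_(y in B) (h t (traj s w) y)%:E)%E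
}.

Definition vol x (r : R) : \bar R := mu (ball x r).

(* V1 makes every volume finite, so fine (vol x r) below is the true volume. *)
Definition V1 := exists2 c : R, 0 < c & forall r : R, 0 < r ->
  ((c * r)%:E < ereal_inf [set vol x r | x in setT])%E /\
  (ereal_sup [set vol x r | x in setT] < +oo)%E.

Definition V2 (beta : R) := forall x,
  (0 < limf_einf (fun r : R => (vol x r)^-1 *
         ereal_inf [set vol y r | y in ball x (r `^ beta * fine (vol x r))%R])
       (+oo%R : set_system R))%E.

Definition GE (beta : R) (h : R -> X -> X -> R) :=
  exists c C : R, [/\ 0 < c, 0 < C & forall x y t, 0 < t ->
    let v := fine (vol x (t `^ beta^-1)) in
    let q := (mdist x y `^ beta / t) `^ (beta - 1)^-1 in
    c / v * expR (- (C * q)) <= h t x y <= C / v * expR (- (c * q))].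

Section sausage.
Context (h : R -> X -> X -> R) d (W : measurableType d).
Variable D : diffusion h W.

Definition sample_path t (w : W) : set X := [set traj D s w | s in `[0, t]].

Definition sausage (eps : R) t (w : W) : set X :=
  \bigcup_(z in sample_path t w) ball z eps.

(* E^x[exp(- nu mu(C_t^eps))], with exp(-oo) = 0. *)
Definition sausage_laplace (eps nu : R) x t : \bar R :=
  \int[D x]_w expeR (- (nu%:E * mu (sausage eps t w)))%E.

End sausage.

End dirichlet.

(* Main.v *)
Require Import Defs.
From HB Require Import structures.
From mathcomp Require Import all_boot all_order all_algebra.
From mathcomp Require Import all_classical all_reals all_analysis.
From mathcomp Require Import measurable_realfun ring lra zify.

Set Implicit Arguments.
Unset Strict Implicit.
Unset Printing Implicit Defensive.
Import Order.TTheory GRing.Theory Num.Theory.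
Import numFieldNormedType.Exports.
Local Open Scope classical_set_scope.
Local Open Scope ring_scope.

(** Everything is read off the transition kernel through the Markov property.
Write V = V(x,t) and T = t^beta V.

The kernel has total mass one, since the paths never leave X.  Integrating the
lower kernel bound over a ball therefore gives volume doubling ([doubling]), and
comparing the upper bound at time s with the lower bound at a fixed multiple
of s gives the tail bound [transition_tail] with no summation over annuli.

Upper bound on the logarithm.  If the path stays in B(x,t) up to time T, the
sausage lies in B(x,2t), of volume at most a constant times V.  Cut [0,T] into
steps of length (t/A)^beta.  From B(x,t/A), the path is back in B(x,t/A) after
one step with probability bounded below.  A path that has left B(x,t) during
the step must travel (A-1)t/A in the remaining time to be back, which for A
large has at most half that probability.  Hence staying inside costs a
constant factor per step ([confinement]), and there are of order V steps.

Lower bound on the logarithm.  Observe the path at the multiples of t^beta up to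
T, about V times.  Keep greedily a list of observed sites whose balls of radius
eps/2 are disjoint; those balls lie in the sausage.  By doubling, the set of
points too close to the list has measure at most a constant times the total
volume of these balls.  While that volume is below a small multiple of V and
the path is in B(x,T), where (V2) bounds below the volume of balls of radius t,
the next observation falls in this set with probability at most 1/2
([Pr_revisit]).  Otherwise a ball, of volume bounded below by (V1), is added.
So each observation multiplies the expected exponential by a factor below one
([level_sum]), unless the volume already exceeds a multiple of V or the path
has left B(x,T), an event of probability exponentially small in T
([Pr_escapes]).  The three contributions are each exponentially small in V
([sausage_laplace_decay]). *)

(** * Integration, events and the Markov property *)

(** The integral of a nonnegative function is a supremum over the simple
    functions below it, so it is monotone whether or not the integrands are
    measurable. This spares proving that the transition probabilities and the
    volume of the sausage are measurable in the path. *)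
Lemma ge0_le_integral_nonmeas d (T : measurableType d) (R : realType)
    (m : {measure set T -> \bar R}) (A : set T) (f g : T -> \bar R) :
  (forall x, A x -> (0 <= f x)%E) -> (forall x, A x -> (f x <= g x)%E) ->
  (\int[m]_(x in A) f x <= \int[m]_(x in A) g x)%E.
Proof.
move=> f0 fg; rewrite !ge0_integralE//; last first.
  by move=> x Ax; exact: le_trans (f0 _ Ax) (fg _ Ax).
apply: le_ereal_sup => _ [k /= kf <-]; exists k => // x.
apply: le_trans (kf x) _.
by apply: lee_restrict.
Qed.

Lemma open_metric_ball (R : realType) (X : completeMetricType R) (z : X) (r : R) :
  open (ball z r).
Proof.
rewrite ballEmdist openE => y /= zy.
apply/nbhs_ballP; exists (r - mdist z y) => /=; first by rewrite subr_gt0.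
move=> u; rewrite ballEmdist /= => yu.
by have := metric_triangle z y u; lra.
Qed.

Lemma borel_ball (R : realType) (X : completeMetricType R) (z : X) (r : R) :
  measurable (ball z r : set (borel X)).
Proof. by apply: sub_sigma_algebra; exact: open_metric_ball. Qed.

Definition transition (R : realType) (X : completeMetricType R)
    (mu : {measure set (borel X) -> \bar R}) (h : R -> X -> X -> R)
    (t : R) (x : X) (B : set (borel X)) : \bar R :=
  (\int[mu]_(y in B) (h t x y)%:E)%E.

Section process.
Context {R : realType} {X : completeMetricType R}.
Context {mu : {measure set (borel X) -> \bar R}} {h : R -> X -> X -> R}.
Context {d : measure_display} {W : measurableType d} (D : diffusion mu h W).

Definition past (s : R) : set (set W) :=
  <<s [set G | exists (r : R) (A : set (borel X)),
         [/\ 0 <= r <= s, measurable A & G = traj D r @^-1` A]] >>.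

Lemma measurable_traj (s : R) (B : set (borel X)) : 0 <= s -> measurable B ->
  measurable (traj D s @^-1` B).
Proof.
by move=> s0 mB; rewrite -[X in measurable X]setTI; exact: (traj_measurable D s0).
Qed.

Lemma past_traj (r s : R) (A : set (borel X)) : 0 <= r <= s -> measurable A ->
  past s (traj D r @^-1` A).
Proof. by move=> rs mA; apply: sub_sigma_algebra; exists r, A. Qed.

Lemma past_mono (r s : R) : r <= s -> past r `<=` past s.
Proof.
move=> rs; apply: sub_sigma_algebra2 => _ [u [A [/andP[u0 ur] mA ->]]].
by exists u, A; split => //; rewrite u0 (le_trans ur).
Qed.

Lemma past_measurable (s : R) (F : set W) : past s F -> measurable F.
Proof.
move: F; apply: smallest_sub; first exact: sigma_algebra_measurable.
move=> _ [u [A [/andP[u0 us] mA ->]]].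
exact: measurable_traj.
Qed.

Lemma pastI (s : R) (F G : set W) : past s F -> past s G -> past s (F `&` G).
Proof. exact: (@measurableI _ (g_sigma_algebraType _)). Qed.

Lemma pastU (s : R) (F G : set W) : past s F -> past s G -> past s (F `|` G).
Proof. exact: (@measurableU _ (g_sigma_algebraType _)). Qed.

Lemma pastD (s : R) (F G : set W) : past s F -> past s G -> past s (F `\` G).
Proof. exact: (@measurableD _ (g_sigma_algebraType _)). Qed.

Lemma measurable_trajI (s : R) (F : set W) (B : set (borel X)) : 0 <= s ->
  measurable F -> measurable B -> measurable (F `&` traj D s @^-1` B).
Proof.
by move=> s0 mF mB; apply: measurableI => //; exact: measurable_traj.
Qed.

Lemma measurable_point (z : X) : measurable ([set z] : set (borel X)).
Proof.
rewrite -[X in measurable X]setCK; apply: measurableC; apply: sub_sigma_algebra.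
rewrite /= openC; apply: accessible_closed_set1.
exact: hausdorff_accessible (@metric_hausdorff _ X).
Qed.

Hypothesis h_ge0 : forall (t : R) x y, 0 < t -> 0 <= h t x y.

(** The event that the path starts at x belongs to the past of time 0 and has
    full probability, and on it the inner integral of the Markov property is
    constant. *)
Lemma law_traj x t (B : set (borel X)) : 0 < t -> measurable B ->
  D x (traj D t @^-1` B) = transition mu h t x B.
Proof.
move=> t0 mB; pose F := traj D 0 @^-1` [set x].
have pF : past 0 F by apply: past_traj; [rewrite !lexx | exact: measurable_point].
have mF := past_measurable pF.
have PF : D x F = 1%E by exact: traj_start.
have PFC : D x (~` F) = 0%E by rewrite probability_setC// PF subee.
have mB' : measurable (traj D t @^-1` B) by apply: measurable_traj => //; exact: ltW.
have z0 : D x (~` F `&` traj D t @^-1` B) = 0%E.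
  apply: (subset_measure0 _ _ _ PFC) => //; last exact: measurableC.
  by apply: measurableI => //; exact: measurableC.
have -> : D x (traj D t @^-1` B) = D x (F `&` traj D t @^-1` B).
  have TE : traj D t @^-1` B =
      (F `&` traj D t @^-1` B) `|` (~` F `&` traj D t @^-1` B).
    by rewrite -setIUl setUv setTI.
  rewrite {1}TE measureU//; last 3 first.
  - exact: measurableI.
  - by apply: measurableI => //; exact: measurableC.
  - by rewrite setIACA setICr set0I.
  by rewrite [X in (_ + X)%E]z0 adde0.
rewrite -[X in traj D X]add0r (traj_markov _ (lexx 0) t0 pF mB).
rewrite (@eq_integral _ _ _ _ _ (cst (transition mu h t x B))).
  by rewrite integral_cst// [X in (_ * X)%E]PF mule1.
by move=> w; rewrite inE /F /= => ->.
Qed.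

(** Conservativeness: the whole space is the target set, and the paths are
    defined at all times. *)
Lemma kernel_mass x t : 0 < t -> transition mu h t x setT = 1%E.
Proof. by move=> t0; rewrite -law_traj// preimage_setT probability_setT. Qed.

Lemma transition_ge0 t x B : 0 < t -> (0 <= transition mu h t x B)%E.
Proof. by move=> t0; apply: integral_ge0 => y _; rewrite lee_fin h_ge0. Qed.

Lemma markov_le x s t F (B : set (borel X)) (b : R) : 0 <= s -> 0 < t ->
  past s F -> measurable B ->
  (forall w, F w -> (transition mu h t (traj D s w) B <= b%:E)%E) ->
  (D x (F `&` traj D (s + t) @^-1` B) <= b%:E * D x F)%E.
Proof.
move=> s0 t0 pF mB hb; rewrite (traj_markov _ s0 t0 pF mB).
rewrite -integral_cst; last exact: past_measurable pF.
by apply: ge0_le_integral_nonmeas => // w _; exact: transition_ge0.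
Qed.

Lemma markov_ge x s t F (B : set (borel X)) (b : R) : 0 <= s -> 0 < t ->
  past s F -> measurable B -> 0 <= b ->
  (forall w, F w -> (b%:E <= transition mu h t (traj D s w) B)%E) ->
  (b%:E * D x F <= D x (F `&` traj D (s + t) @^-1` B))%E.
Proof.
move=> s0 t0 pF mB b0 hb; rewrite (traj_markov _ s0 t0 pF mB).
rewrite -integral_cst; last exact: past_measurable pF.
exact: ge0_le_integral_nonmeas.
Qed.

Definition Pr x (F : set W) : R := fine (D x F).

Lemma PrE x F : measurable F -> D x F = (Pr x F)%:E.
Proof. by move=> mF; rewrite /Pr fineK// fin_num_measure. Qed.

Lemma Pr_ge0 x F : 0 <= Pr x F.
Proof. exact/fine_ge0/measure_ge0. Qed.

Lemma Pr_le1 x F : measurable F -> Pr x F <= 1.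
Proof. by move=> mF; rewrite -lee_fin -PrE// probability_le1. Qed.

Lemma le_Pr x F G : measurable F -> measurable G -> F `<=` G ->
  Pr x F <= Pr x G.
Proof.
by move=> mF mG FG; rewrite -lee_fin -!PrE//; apply: le_measure; rewrite ?inE.
Qed.

Lemma PrU x F G : measurable F -> measurable G -> F `&` G = set0 ->
  Pr x (F `|` G) = Pr x F + Pr x G.
Proof.
move=> mF mG FG; apply: EFin_inj; rewrite EFinD -!PrE//; last exact: measurableU.
exact: measureU.
Qed.

Lemma PrID x F G : measurable F -> measurable G ->
  Pr x F = Pr x (F `&` G) + Pr x (F `\` G).
Proof.
move=> mF mG; rewrite -PrU; first by rewrite setUIDK.
- exact: measurableI.
- exact: measurableD.
- by rewrite setDE setIACA setICr setI0.
Qed.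

Lemma Pr_markov_le x s t F (B : set (borel X)) (b : R) : 0 <= s -> 0 < t ->
  past s F -> measurable B ->
  (forall w, F w -> (transition mu h t (traj D s w) B <= b%:E)%E) ->
  Pr x (F `&` traj D (s + t) @^-1` B) <= b * Pr x F.
Proof.
move=> s0 t0 pF mB hb; have mF := past_measurable pF.
have mI : measurable (F `&` traj D (s + t) @^-1` B).
  by apply: measurable_trajI => //; rewrite addr_ge0// ltW.
by rewrite -lee_fin EFinM -!PrE//; exact: markov_le.
Qed.

Lemma Pr_markov_ge x s t F (B : set (borel X)) (b : R) : 0 <= s -> 0 < t ->
  past s F -> measurable B -> 0 <= b ->
  (forall w, F w -> (b%:E <= transition mu h t (traj D s w) B)%E) ->
  b * Pr x F <= Pr x (F `&` traj D (s + t) @^-1` B).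
Proof.
move=> s0 t0 pF mB b0 hb; have mF := past_measurable pF.
have mI : measurable (F `&` traj D (s + t) @^-1` B).
  by apply: measurable_trajI => //; rewrite addr_ge0// ltW.
by rewrite -lee_fin EFinM -!PrE//; exact: markov_ge.
Qed.

End process.

(** * Doubling and tail bounds from the two-sided kernel estimate *)

(** The sub-Gaussian exponent: with time written r^beta, the quantity (d^beta
    / r^beta)^(1/(beta-1)) is [profile beta (d / r)]. *)
Definition profile (R : realType) (beta a : R) := a `^ (beta / (beta - 1)).

(** The hypotheses on volume and kernel with all constants named. Time is
    parametrized by its length scale r through r^beta, so that the volume in
    the kernel bounds is that of a ball of radius r. *)
Record kernel_bounds (R : realType) (X : completeMetricType R)
    (mu : {measure set (borel X) -> \bar R}) (h : R -> X -> X -> R)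
    (beta c C c1 : R) : Prop := KernelBounds {
  kb_beta : 1 < beta ;
  kb_c : 0 < c ;
  kb_C : 0 < C ;
  kb_c1 : 0 < c1 ;
  kb_meas : forall t : R, 0 < t ->
    measurable_fun setT (fun z : borel X * borel X => h t z.1 z.2) ;
  kb_vol : forall x (r : R), 0 < r -> vol mu x r = (fine (vol mu x r))%:E ;
  kb_lin : forall x (r : R), 0 < r -> c1 * r <= fine (vol mu x r) ;
  kb_ge : forall x y (r : R), 0 < r ->
    c / fine (vol mu x r) * expR (- (C * profile beta (mdist x y / r)))
      <= h (r `^ beta) x y
      <= C / fine (vol mu x r) * expR (- (c * profile beta (mdist x y / r)))
}.

Section kernel.
Context {R : realType} {X : completeMetricType R}.
Context {mu : {measure set (borel X) -> \bar R}} {h : R -> X -> X -> R}.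
Context {d : measure_display} {W : measurableType d} (D : diffusion mu h W).
Context (beta c C c1 : R).
Hypothesis K : kernel_bounds mu h beta c C c1.

Notation V x r := (fine (vol mu x r)).

Let beta1 : 1 < beta. Proof. by case: K. Qed.
Let c0 : 0 < c. Proof. by case: K. Qed.
Let C0 : 0 < C. Proof. by case: K. Qed.
Let c10 : 0 < c1. Proof. by case: K. Qed.
Let h_meas := kb_meas K.
Let volE := kb_vol K.
Let V_lin := kb_lin K.
Let ge := kb_ge K.
Let b0 : 0 < beta. Proof. by apply: lt_trans beta1. Qed.
Let e0 : 0 < beta / (beta - 1). Proof. by rewrite divr_gt0// subr_gt0. Qed.

Lemma V_gt0 x r : 0 < r -> 0 < V x r.
Proof. by move=> r0; apply: lt_le_trans (V_lin _ r0); rewrite mulr_gt0. Qed.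

Lemma le_V x y r s : 0 < r -> 0 < s -> ball x r `<=` ball y s -> V x r <= V y s.
Proof.
move=> r0 s0 rs; rewrite -lee_fin -!volE// /vol.
by apply: le_measure; rewrite ?inE//; exact: borel_ball.
Qed.

Lemma root_time t : 0 < t -> 0 < t `^ beta^-1 /\ (t `^ beta^-1) `^ beta = t.
Proof.
move=> t0; split; first exact: powR_gt0.
by rewrite -powRrM mulVf ?gt_eqF// powRr1// ltW.
Qed.

Lemma kernel_ge0 t x y : 0 < t -> 0 <= h t x y.
Proof.
move=> t0; have [r0 <-] := root_time t0.
have /andP[+ _] := ge x y r0; apply: le_trans.
by rewrite mulr_ge0// ?expR_ge0// divr_ge0 ?ltW// V_gt0.
Qed.

Lemma measurable_kernel (t : R) x : 0 < t ->
  measurable_fun setT (EFin \o h t x : borel X -> \bar R).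
Proof.
move=> t0; apply: measurableT_comp => //.
exact: (measurableT_comp (h_meas t0) (pair1_measurable (x : borel X))).
Qed.

Lemma le_profile a b : 0 <= a -> a <= b -> profile beta a <= profile beta b.
Proof.
move=> a0 ab; apply: ge0_ler_powR => //; first exact: ltW.
by rewrite nnegrE (le_trans a0).
Qed.

Lemma profileM a b : 0 <= a -> 0 <= b -> profile beta (a * b) = profile beta a * profile beta b.
Proof. exact: powRM. Qed.

(** The exponent beta / (beta - 1) is at least 1. *)
Lemma profile_ge_id a : 1 <= a -> a <= profile beta a.
Proof.
move=> a1; apply: le1r_powR => //.
by rewrite ler_pdivlMr ?subr_gt0//; lra.
Qed.

Lemma kernel_near x y r l : 0 < r -> 0 < l -> mdist x y <= l * r ->
  c / V x r * expR (- (C * profile beta l)) <= h (r `^ beta) x y.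
Proof.
move=> r0 l0 xy; have /andP[+ _] := ge x y r0; apply: le_trans.
rewrite ler_wpM2l//; first by rewrite divr_ge0 ?ltW// V_gt0.
rewrite ler_expR lerN2 ler_wpM2l// ?(ltW C0)// le_profile//.
  by rewrite divr_ge0// ?mdist_ge0// ltW.
by rewrite ler_pdivrMr.
Qed.

Lemma kernel_far x y r l : 0 < r -> 0 <= l -> l * r <= mdist x y ->
  h (r `^ beta) x y <= C / V x r * expR (- (c * profile beta l)).
Proof.
move=> r0 l0 xy; have /andP[_ +] := ge x y r0; move=> /le_trans; apply.
rewrite ler_wpM2l//; first by rewrite divr_ge0 ?ltW// V_gt0.
by rewrite ler_expR lerN2 ler_wpM2l// ?(ltW c0)// le_profile// ler_pdivlMr.
Qed.

Lemma kernel_le x y r : 0 < r -> h (r `^ beta) x y <= C / V x r.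
Proof.
move=> r0; have := @kernel_far x y r 0 r0 (lexx _).
by rewrite mul0r /profile powR0 ?gt_eqF// mulr0 oppr0 expR0 mulr1; apply; exact: mdist_ge0.
Qed.

Lemma transition_ge x r (B : set (borel X)) a b : 0 < r -> measurable B ->
  0 <= a -> (forall y, B y -> a <= h (r `^ beta) x y) -> (b%:E <= mu B)%E ->
  ((a * b)%:E <= transition mu h (r `^ beta) x B)%E.
Proof.
move=> r0 mB a0 ah bB; apply: (@le_trans _ _ (\int[mu]_(y in B) a%:E)%E).
  by rewrite integral_cst// EFinM lee_wpmul2l// lee_fin.
by apply: ge0_le_integral_nonmeas => y By; rewrite lee_fin ?ah.
Qed.

Definition doubling_const l := expR (C * profile beta l) / c.

Lemma doubling_const_gt0 l : 0 < doubling_const l. Proof. by rewrite divr_gt0// expR_gt0. Qed.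

(** On B(x, l r) the lower bound makes the kernel at time r^beta at least a
    constant over V(x,r), while its total mass is one. *)
Lemma doubling x r l : 0 < r -> 0 < l -> V x (l * r) <= doubling_const l * V x r.
Proof.
move=> r0 l0; have lr0 : 0 < l * r by rewrite mulr_gt0.
have vr := V_gt0 x r0.
have : (((c / V x r * expR (- (C * profile beta l))) * V x (l * r))%:E <= 1%:E)%E.
  rewrite -(kernel_mass D x (powR_gt0 beta r0)).
  apply: (@le_trans _ _ (transition mu h (r `^ beta) x (ball x (l * r)))).
    apply: transition_ge => //; first exact: borel_ball.
    - by rewrite mulr_ge0// ?expR_ge0// divr_ge0// ltW.
    - by move=> y; rewrite ballEmdist /= => xy; apply: kernel_near => //; exact: ltW.
    - by rewrite -volE.
  apply: ge0_subset_integral => //; first exact: borel_ball.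
  - exact: measurable_kernel (powR_gt0 beta r0).
  - by move=> y _; rewrite lee_fin kernel_ge0// powR_gt0.
rewrite lee_fin /doubling_const expRN => H.
have := ler_wpM2l (_ : 0 <= expR (C * profile beta l) / c * V x r) H.
rewrite mulr1; set e := expR _; have e_gt0 : 0 < e by exact: expR_gt0.
have -> : e / c * V x r * (c / V x r / e * V x (l * r)) = V x (l * r).
  by field; rewrite !gt_eqF.
by apply; rewrite !mulr_ge0// ltW// invr_gt0.
Qed.

(** The ratio of length scales at which the exponent C of the lower bound
    turns into half of the exponent c of the upper bound; see
    [profile_stretch]. *)
Definition stretch := (2 * C / c) `^ ((beta - 1) / beta).

Lemma stretch_gt0 : 0 < stretch.
Proof. by rewrite powR_gt0// divr_gt0// mulr_gt0. Qed.

Lemma profile_stretch : profile beta stretch = 2 * C / c.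
Proof.
rewrite /profile /stretch -powRrM mulrA mulfVK ?gt_eqF// divff ?gt_eqF ?subr_gt0//.
by rewrite powRr1// divr_ge0 ?mulr_ge0 ?ltW.
Qed.

Definition tail_const := C / c * doubling_const stretch.

Lemma tail_const_gt0 : 0 < tail_const.
Proof. by rewrite mulr_gt0 ?doubling_const_gt0// divr_gt0. Qed.

(** Half of the upper exponent pays for the lower exponent at the longer time
    and the other half remains as a gain; the two volumes are comparable by
    doubling. *)
Lemma kernel_dominated x y r l : 0 < r -> 0 <= l -> l * r <= mdist x y ->
  h (r `^ beta) x y <= tail_const * expR (- (c / 2 * profile beta l)) *
                       h ((stretch * r) `^ beta) x y.
Proof.
move=> r0 l0 xy; set a := mdist x y / r.
have al : l <= a by rewrite ler_pdivlMr.
have m0 := stretch_gt0; have mr0 : 0 < stretch * r by rewrite mulr_gt0.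
have /andP[_ +] := ge x y r0; move/le_trans; apply.
have /andP[+ _] := ge x y mr0.
have -> : mdist x y / (stretch * r) = a / stretch.
  by rewrite /a invfM mulrAC mulrA.
have -> : profile beta (a / stretch) = profile beta a * (c / (2 * C)).
  have a0 : 0 <= a / stretch.
    by apply: divr_ge0; [exact: le_trans al | exact: ltW].
  have := profileM a0 (ltW m0); rewrite profile_stretch (mulfVK (lt0r_neq0 m0)) => ->.
  by field; rewrite (gt_eqF c0) (gt_eqF C0).
have -> : C * (profile beta a * (c / (2 * C))) = c / 2 * profile beta a.
  by field; rewrite (gt_eqF C0).
rewrite -/a.
have -> : c * profile beta a = c / 2 * profile beta a + c / 2 * profile beta a by lra.
have Vm := doubling x r0 m0.
have v1 := V_gt0 x r0; have v2 := V_gt0 x mr0.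
have Al : expR (- (c / 2 * profile beta a)) <= expR (- (c / 2 * profile beta l)).
  by rewrite ler_expR lerN2 ler_wpM2l ?divr_ge0 ?(ltW c0)// le_profile.
rewrite opprD expRD => hm.
have k0 : 0 <= tail_const * expR (- (c / 2 * profile beta l)).
  by rewrite mulr_ge0 ?expR_ge0// ltW// tail_const_gt0.
apply: le_trans (ler_wpM2l k0 hm).
rewrite mulrA [leRHS]mulrCA mulrA [leRHS]mulrAC.
rewrite [leRHS](_ : _ = tail_const * (c / V x (stretch * r)) *
   expR (- (c / 2 * profile beta l)) * expR (- (c / 2 * profile beta a))); last by lra.
apply: ler_wpM2r; first exact: expR_ge0.
apply: ler_pM Al; [by rewrite divr_ge0// ltW | exact: expR_ge0 |].
have -> : tail_const * (c / V x (stretch * r)) = C * doubling_const stretch / V x (stretch * r).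
  by rewrite /tail_const; field; rewrite (gt_eqF c0) (gt_eqF v2).
rewrite ler_pdivrMr// mulrAC ler_pdivlMr//.
by rewrite -mulrA ler_wpM2l// ltW.
Qed.

(** Integrate [kernel_dominated]: the kernel at the longer time has mass at
    most one. *)
Lemma transition_tail x r l (B : set (borel X)) : 0 < r -> 0 <= l -> measurable B ->
  (forall y, B y -> l * r <= mdist x y) ->
  (transition mu h (r `^ beta) x B <= (tail_const * expR (- (c / 2 * profile beta l)))%:E)%E.
Proof.
move=> r0 l0 mB hB; set k := tail_const * _.
have k0 : 0 <= k by rewrite mulr_ge0 ?expR_ge0// ltW// tail_const_gt0.
have mr0 : 0 < (stretch * r) `^ beta.
  by rewrite powR_gt0// mulr_gt0// stretch_gt0.
pose f (y : borel X) := (k * h ((stretch * r) `^ beta) x y)%:E.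
apply: (@le_trans _ _ (\int[mu]_(y in B) f y)%E).
  apply: ge0_le_integral_nonmeas => y By; rewrite lee_fin ?kernel_ge0 ?powR_gt0//.
  by apply: kernel_dominated => //; exact: hB.
rewrite -[leRHS]mule1 -(kernel_mass D x mr0) /transition /f.
under eq_integral do rewrite EFinM.
rewrite ge0_integralZl//; last 2 first.
  by apply: measurable_funTS; exact: measurable_kernel.
  by move=> y _; rewrite lee_fin kernel_ge0.
apply: lee_wpmul2l; first by rewrite lee_fin.
apply: ge0_subset_integral => //; first exact: measurable_kernel.
by move=> y _; rewrite lee_fin kernel_ge0.
Qed.

Lemma transition_le_vol x r (B : set (borel X)) b : 0 < r -> measurable B ->
  (mu B <= b%:E)%E -> (transition mu h (r `^ beta) x B <= (C / V x r * b)%:E)%E.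
Proof.
move=> r0 mB Bb; have v0 := V_gt0 x r0.
apply: (@le_trans _ _ (\int[mu]_(y in B) (C / V x r)%:E)%E).
  apply: ge0_le_integral_nonmeas => y By; rewrite lee_fin ?kernel_ge0 ?powR_gt0//.
  exact: kernel_le.
rewrite integral_cst// [leRHS]EFinM; apply: lee_wpmul2l => //.
by rewrite lee_fin divr_ge0// ltW.
Qed.

Definition return_rate := c * expR (- (C * profile beta 2)) / doubling_const 2.

Lemma return_rate_gt0 : 0 < return_rate.
Proof. by rewrite divr_gt0 ?doubling_const_gt0// mulr_gt0// expR_gt0. Qed.

Lemma V_center_le x z r l : 0 < r -> 0 < l -> mdist x z <= l * r ->
  V z r <= doubling_const (l + 1) * V x r.
Proof.
move=> r0 l0 xz; have l1 : 0 < l + 1 by rewrite addr_gt0.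
apply: le_trans (doubling x r0 l1); apply: le_V => //; first exact: mulr_gt0.
move=> y; rewrite !ballEmdist /= => zy.
by apply: le_lt_trans (metric_triangle x z y) _; rewrite mulrDl mul1r ler_ltD.
Qed.

(** Within distance 2r the kernel at time r^beta is at least a constant over
    V(z,r), which doubling compares with V(x,r). *)
Lemma transition_return x z r : 0 < r -> mdist x z <= r ->
  (return_rate%:E <= transition mu h (r `^ beta) z (ball x r))%E.
Proof.
move=> r0 xz; have vz := V_gt0 z r0; have vx := V_gt0 x r0.
have zx : V z r <= doubling_const 2 * V x r.
  have -> : 2 = 1 + 1 :> R by lra.
  by apply: V_center_le => //; rewrite mul1r.
apply: (@le_trans _ _ ((c / V z r * expR (- (C * profile beta 2))) * V x r)%:E).
  rewrite lee_fin /return_rate ler_pdivrMr ?doubling_const_gt0//.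
  set e := expR _; have e_gt0 : 0 < e by exact: expR_gt0.
  have -> : c / V z r * e * V x r * doubling_const 2 = c * e * (doubling_const 2 * V x r / V z r).
    by field; rewrite gt_eqF.
  by rewrite ler_peMr ?mulr_ge0 ?(ltW c0) ?(ltW e_gt0)// ler_pdivlMr// mul1r.
apply: transition_ge => //; first exact: borel_ball.
- by rewrite mulr_ge0// ?expR_ge0// divr_ge0// ltW.
- move=> y; rewrite ballEmdist /= => xy; apply: kernel_near => //.
  apply: le_trans (metric_triangle z x y) _; rewrite metric_sym.
  by rewrite (_ : 2 * r = r + r) ?lerD// ?(ltW xy)//; lra.
- by rewrite -volE.
Qed.

End kernel.

(** * Confinement of the path in a ball *)

(** Used to absorb multiplicative constants into exponential decay. *)
Lemma expR_small (R : realType) (k a e : R) : 0 < k -> 0 < a -> 0 < e ->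
  exists2 M, 1 <= M & forall y, M <= y -> k * expR (- (a * y)) <= e.
Proof.
move=> k0 a0 e0; have ae0 : 0 < a * e by rewrite mulr_gt0.
exists (1 + k / (a * e)); first by rewrite lerDl divr_ge0// ltW.
move=> y My; have y0 : 0 < a * y.
  by rewrite mulr_gt0// (lt_le_trans _ My)// ltr_pwDl// divr_ge0// ltW.
rewrite expRN ler_pdivrMr ?expR_gt0//.
have /(ler_wpM2l (ltW e0)) := expR_ge1Dx (a * y); apply: le_trans.
have : k / (a * e) <= y by lra.
by rewrite ler_pdivrMr// => ky; nra.
Qed.

Section confinement.
Context {R : realType} {X : completeMetricType R}.
Context {mu : {measure set (borel X) -> \bar R}} {h : R -> X -> X -> R}.
Context {d : measure_display} {W : measurableType d} (D : diffusion mu h W).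
Context (beta c C c1 : R).
Hypothesis K : kernel_bounds mu h beta c C c1.

Let beta0 : 0 < beta. Proof. exact: lt_trans (kb_beta K). Qed.

(** A time shorter than r^beta has a smaller length scale, so the tail bound
    at scale r covers it. *)
Lemma transition_tail_time x (t r l : R) (B : set (borel X)) :
  0 < t -> 0 < r -> t <= r `^ beta -> 0 <= l -> measurable B ->
  (forall y, B y -> l * r <= mdist x y) ->
  (transition mu h t x B <= (tail_const beta c C * expR (- (c / 2 * profile beta l)))%:E)%E.
Proof.
move=> t0 r0 tr l0 mB hB; have [u0 <-] := root_time K t0.
apply: (transition_tail D K) => // y /hB; apply: le_trans; rewrite ler_wpM2l//.
rewrite -[leRHS](powRr1 (ltW r0)) -(divff (lt0r_neq0 beta0)) powRrM.
apply: ge0_ler_powR => //; first by rewrite invr_ge0 ltW.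
  exact: ltW.
by rewrite nnegrE powR_ge0.
Qed.

Variables (x : X) (r A : R).
Hypothesis r0 : 0 < r.
Hypothesis A1 : 1 <= A.
Let b := tail_const beta c C * expR (- (c / 2 * profile beta (A - 1))).
Let rr := return_rate beta c C.
Let tau := r `^ beta.
Let tau0 : 0 < tau. Proof. exact: powR_gt0. Qed.

(** Recursive rather than an existential over grid times (compare [exitsP]),
    to follow the induction of [exit_return]. *)
Fixpoint exits (s eta : R) (n : nat) : set W :=
  if n is m.+1 then
    exits s eta m `|` traj D (s + m.+1%:R * eta) @^-1` (~` ball x (A * r))
  else set0.

Lemma exitsP s eta n w :
  exits s eta n w <->
  exists2 i, (0 < i <= n)%N & ~ ball x (A * r) (traj D (s + i%:R * eta) w).
Proof.
elim: n => [|n IH] /=; first by split => // -[i]; lia.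
split => [[/IH[i i_n ?]|?]|[i i_n ?]]; first by exists i => //; lia.
  by exists n.+1 => //; lia.
have [ie|ni] := eqVneq i n.+1; first by right; rewrite -ie.
by left; apply/IH; exists i => //; lia.
Qed.

Lemma past_exits s eta n t : 0 <= s -> 0 <= eta -> s + n%:R * eta <= t ->
  past D t (exits s eta n).
Proof.
move=> s0 eta0; elim: n t => [|n IH] t st /=; first exact: sigma_algebra0.
have st' : s + n%:R * eta <= s + n.+1%:R * eta.
  by rewrite lerD2l ler_wpM2r// ler_nat.
apply: pastU; first by apply: IH; exact: le_trans st.
apply: past_traj; first by rewrite st andbT addr_ge0// mulr_ge0.
by apply: measurableC; exact: borel_ball.
Qed.

Lemma transition_back t z : 0 < t -> t <= tau -> ~ ball x (A * r) z ->
  (transition mu h t z (ball x r) <= b%:E)%E.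
Proof.
move=> t0 tt; rewrite ballEmdist => /negP; rewrite -leNgt => xz.
apply: (transition_tail_time t0 r0 tt); [by rewrite subr_ge0 | exact: borel_ball |].
move=> y; rewrite ballEmdist /= => xy.
have := metric_triangle x y z; rewrite (metric_sym y z); lra.
Qed.

(** A reflection argument on the grid: split according to the first grid time
    spent outside B(x, A r). That event belongs to the past of that time, from
    which the return has probability at most b. *)
Lemma exit_return x0 s eta n F : 0 <= s -> 0 <= eta -> n%:R * eta < tau ->
  past D s F ->
  Pr D x0 (F `&` exits s eta n `&` traj D (s + tau) @^-1` (ball x r))
    <= b * Pr D x0 (F `&` exits s eta n).
Proof.
move=> s0 eta0 nt pF; elim: n nt => [|n IH] nt.
  by rewrite /= setI0 set0I /Pr measure0 mulr0.
have nn : n%:R * eta <= n.+1%:R * eta by rewrite ler_wpM2r// ler_nat.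
pose u := s + n.+1%:R * eta.
have u0 : 0 <= u by rewrite addr_ge0// mulr_ge0.
have su : s <= u by rewrite lerDl mulr_ge0.
pose G := F `&` exits s eta n.
pose H := F `&` traj D u @^-1` (~` ball x (A * r)) `\` G.
have pG : past D u G.
  by apply: pastI; [exact: past_mono pF | apply: past_exits => //; rewrite lerD2l].
have pH : past D u H.
  apply: pastD => //; apply: pastI; first exact: past_mono pF.
  apply: past_traj; first by rewrite u0 lexx.
  by apply: measurableC; exact: borel_ball.
have FE : F `&` exits s eta n.+1 = G `|` H.
  apply/seteqP; split=> w; rewrite /H /G /setI /setU /setD /u /=.
    by have [?|?] := pselect (exits s eta n w); tauto.
  by tauto.
have GH : G `&` H = set0 by rewrite /H setDE setICA setICr setI0.
set T := traj D (s + tau) @^-1` _.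
have mT : measurable T.
  apply: measurable_traj => //.
    by rewrite addr_ge0// ltW.
  exact: borel_ball.
have [mG mH] := (past_measurable pG, past_measurable pH).
rewrite FE setIUl !PrU//; [|exact: measurableI|exact: measurableI|].
  rewrite mulrDr lerD//; first by apply: IH; exact: le_lt_trans nt.
  rewrite /T (_ : s + tau = u + (tau - n.+1%:R * eta)); last by rewrite /u; ring.
  apply: (Pr_markov_le (kernel_ge0 K)) => //.
  - by rewrite subr_gt0.
  - exact: borel_ball.
  move=> w [[_ /= xw] _]; apply: transition_back => //; first by rewrite subr_gt0.
  by rewrite lerBlDr lerDl mulr_ge0.
by rewrite setIACA GH set0I.
Qed.

Hypothesis b_le : b <= rr / 2.

(** At the k first multiples of tau the path is in B(x,r), and at the grid
    times in between it is in B(x, A r). *)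
Fixpoint confined (eta : R) (N k : nat) : set W :=
  if k is j.+1 then
    confined eta N j `&` traj D (j%:R * tau + tau) @^-1` ball x r
      `\` (confined eta N j `&` exits (j%:R * tau) eta N.-1
             `&` traj D (j%:R * tau + tau) @^-1` ball x r)
  else traj D 0 @^-1` [set x].

Lemma past_confined eta N k : 0 <= eta -> N%:R * eta = tau ->
  past D (k%:R * tau) (confined eta N k).
Proof.
move=> eta0 Nt; elim: k => [|k IH] /=.
  rewrite mul0r; apply: past_traj; first by rewrite lexx.
  exact: measurable_point.
have k0 : 0 <= k%:R * tau by rewrite mulr_ge0// ltW.
have kt : k.+1%:R * tau = k%:R * tau + tau by rewrite -natr1 mulrDl mul1r.
have pk : past D (k.+1%:R * tau) (confined eta N k).
  by apply: past_mono IH; rewrite kt lerDl ltW.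
have pb : past D (k.+1%:R * tau) (traj D (k%:R * tau + tau) @^-1` ball x r).
  rewrite kt; apply: past_traj; last exact: borel_ball.
  by rewrite lexx addr_ge0// ltW.
apply: pastD; first exact: pastI.
apply: pastI => //; apply: pastI => //; apply: past_exits => //.
rewrite kt lerD2l -Nt ler_wpM2r// ler_nat; exact: leq_pred.
Qed.

Lemma confined_end eta N k w : confined eta N k w -> mdist x (traj D (k%:R * tau) w) <= r.
Proof.
case: k => [|k] /=; first by rewrite mul0r => ->; rewrite mdistxx ltW.
rewrite -natr1 mulrDl mul1r => -[[_ +] _].
by rewrite ballEmdist /= => /ltW.
Qed.

Lemma confined_grid eta N k w i : N%:R * eta = tau -> confined eta N k w ->
  (i <= k * N)%N -> ball x (A * r) (traj D (i%:R * eta) w).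
Proof.
move=> Nt; have ball_r z : ball x r z -> ball x (A * r) z.
  by rewrite !ballEmdist /= => /lt_le_trans; apply; rewrite ler_peMl// ltW.
elim: k i => [|k IH] i /=.
  rewrite mul0n leqn0 => xw /eqP ->; rewrite mul0r xw; apply: ballxx.
  by rewrite mulr_gt0// (lt_le_trans _ A1).
move=> [[ck bk] nex] ik.
have [ikN|kNi] := leqP i (k * N); first exact: IH.
have [iE|iN] := eqVneq i (k.+1 * N)%N.
  by apply: ball_r; rewrite iE natrM -mulrA Nt -natr1 mulrDl mul1r.
apply: contrapT => ni; apply: nex; split => //; split => //.
apply/exitsP; exists (i - k * N)%N; first by rewrite mulSn in ik iN; lia.
by rewrite -Nt mulrA -mulrDl -natrM -natrD subnKC// ltnW.
Qed.

(** A step returns to B(x,r) with probability at least rr, of which at most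
    half is lost to paths that have left B(x, A r) on the way. *)
Lemma Pr_confined eta N k : 0 < eta -> (0 < N)%N -> N%:R * eta = tau ->
  (rr / 2) ^+ k <= Pr D x (confined eta N k).
Proof.
move=> eta0 N0 Nt; elim: k => [|k IH].
  by rewrite expr0 /Pr /= [X in fine X]traj_start.
have pk : past D (k%:R * tau) (confined eta N k) := past_confined (ltW eta0) Nt.
have mk := past_measurable pk.
have k0 : 0 <= k%:R * tau by rewrite mulr_ge0// ltW.
rewrite /=; set F := confined eta N k; set T := _ @^-1` _; set U := F `&` _ `&` _.
have rr0 : 0 <= rr by apply/ltW; exact: (return_rate_gt0 K).
have FT : rr * Pr D x F <= Pr D x (F `&` T).
  apply: (Pr_markov_ge x) => //; first exact: borel_ball.
  by move=> w Fw; apply: (transition_return D K) => //; exact: confined_end Fw.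
have FU : Pr D x U <= b * Pr D x F.
  have bg : 0 <= b by rewrite mulr_ge0 ?expR_ge0// ltW// (tail_const_gt0 K).
  have nt : N.-1%:R * eta < tau by rewrite -Nt ltr_pM2r// ltr_nat prednK.
  apply: (le_trans (exit_return _ k0 (ltW eta0) nt pk)); apply: ler_wpM2l => //.
  have pe : past D (k%:R * tau + N.-1%:R * eta) (F `&` exits (k%:R * tau) eta N.-1).
    apply: pastI; last by apply: past_exits => //; exact: ltW.
    by apply: past_mono pk; rewrite lerDl mulr_ge0// ltW.
  by apply: le_Pr => //; exact: past_measurable pe.
have mT : measurable T.
  apply: measurable_traj => //.
    by rewrite addr_ge0// ltW.
  exact: borel_ball.
have mU : measurable U.
  apply: measurableI => //; apply: measurableI => //.
  apply: (@past_measurable _ _ _ _ _ _ D (k%:R * tau + N.-1%:R * eta)).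
  by apply: past_exits => //; exact: ltW.
have E := PrID D x (measurableI _ _ mk mT) mU.
have I : Pr D x (F `&` T `&` U) <= Pr D x U.
  by apply: le_Pr => //; apply: measurableI => //; exact: measurableI.
have P0 := Pr_ge0 D x F.
have : (rr / 2) ^+ k.+1 <= rr / 2 * Pr D x F.
  by rewrite exprS ler_wpM2l// divr_ge0.
have : b * Pr D x F <= rr / 2 * Pr D x F by exact: ler_wpM2r.
lra.
Qed.

(** Dyadic grids, so that the events decrease with m and their limit is
    governed by all dyadic times. *)
Definition grid (k m : nat) : set W :=
  \bigcap_(i in [set i | (i <= k * 2 ^ m)%N])
    traj D (i%:R * (tau / 2 ^+ m)) @^-1` ball x (A * r).

Let mesh_gt0 m : 0 < tau / 2 ^+ m.
Proof. by rewrite divr_gt0// exprn_gt0. Qed.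

Lemma measurable_grid k m : measurable (grid k m).
Proof.
apply: bigcap_measurable; first by exists 0%N => /=; rewrite leq0n.
move=> i _; apply: measurable_traj => //.
  by rewrite mulr_ge0// ltW.
exact: borel_ball.
Qed.

Lemma Pr_grid k m : (rr / 2) ^+ k <= Pr D x (grid k m).
Proof.
have N0 : (0 < 2 ^ m)%N by rewrite expn_gt0.
have Nt : (2 ^ m)%:R * (tau / 2 ^+ m) = tau.
  by rewrite natrX mulrC mulfVK// gt_eqF// exprn_gt0.
apply: le_trans (Pr_confined k (mesh_gt0 m) N0 Nt) _; apply: le_Pr.
- exact: past_measurable (past_confined (ltW (mesh_gt0 m)) Nt).
- exact: measurable_grid.
- by move=> w cw i /= ik; exact: confined_grid cw ik.
Qed.

Lemma grid_nonincreasing k : nonincreasing_seq (grid k).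
Proof.
apply/nonincreasing_seqP => m; apply/subsetPset => w gw i /= ik.
have /= := gw (2 * i)%N; rewrite expnS mulnCA leq_mul2l/= => /(_ ik).
have -> // : (2 * i)%:R * (tau / 2 ^+ m.+1) = i%:R * (tau / 2 ^+ m) :> R.
by rewrite natrM exprS; field; rewrite gt_eqF// exprn_gt0.
Qed.

(** The path is continuous, and a point outside the closed ball has a whole
    neighbourhood outside the open one, so a grid time close enough to s would
    see the path outside. *)
Lemma grid_confined k w s : (\bigcap_m grid k m) w -> 0 <= s <= k%:R * tau ->
  mdist x (traj D s w) <= A * r.
Proof.
move=> gw /andP[s0 sk]; rewrite leNgt; apply/negP => escapes.
have dl0 : 0 < mdist x (traj D s w) - A * r by rewrite subr_gt0.
have sI : `[0, +oo[%classic s by rewrite /= in_itv /= s0.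
have /subspace_continuousP/(_ s sI) := @traj_continuous _ _ _ _ _ _ D w.
move/(_ _ (nbhsx_ballx _ _ dl0)); rewrite /nbhs /= /within /=.
move=> /nbhs_ballP[e /= e0 he].
have [m me] : exists m, tau / 2 ^+ m < e.
  exists (Num.bound (tau / e)); rewrite ltr_pdivrMr ?exprn_gt0//.
  rewrite -ltr_pdivrMl// mulrC.
  have /lt_trans := archi_boundP (ltW (divr_gt0 tau0 e0)); apply.
  by rewrite -natrX ltr_nat ltn_expl.
have eta0 := mesh_gt0 m; set eta := tau / 2 ^+ m in me eta0.
pose i := Num.truncn (s / eta).
have /andP[il iu] := truncn_itv (divr_ge0 s0 (ltW eta0)).
rewrite ler_pdivlMr// in il; rewrite ltr_pdivrMr// -natr1 mulrDl mul1r in iu.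
have ik : (i <= k * 2 ^ m)%N.
  rewrite -(@ler_nat R) natrM natrX -(ler_pM2r eta0) (le_trans il)//.
  by rewrite -mulrA /eta (mulrC (2 ^+ m)) mulfVK ?gt_eqF// exprn_gt0.
have := gw m I i ik; rewrite -/eta /= ballEmdist /= => near_x.
have /= hi : ball (traj D s w) (mdist x (traj D s w) - A * r) (traj D (i%:R * eta) w).
  apply: he; first by rewrite /ball /= ger0_norm; lra.
  by rewrite in_itv /= andbT mulr_ge0// ltW.
rewrite ballEmdist /= in hi.
have := metric_triangle x (traj D (i%:R * eta) w) (traj D s w).
by rewrite (metric_sym (traj D (i%:R * eta) w) (traj D s w)); lra.
Qed.

(** The lower bound of [Pr_grid] is uniform in the mesh and passes to the
    decreasing intersection of the grid events. *)
Lemma confinement k : exists G, [/\ measurable G, (rr / 2) ^+ k <= Pr D x G &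
  forall w s, G w -> 0 <= s <= k%:R * tau -> mdist x (traj D s w) <= A * r].
Proof.
have mG : measurable (\bigcap_m grid k m).
  by apply: bigcapT_measurable => m; exact: measurable_grid.
exists (\bigcap_m grid k m); split => //; last by move=> w s; exact: grid_confined.
rewrite -lee_fin -PrE//.
have cv : D x (grid k m) @[m --> \oo] --> D x (\bigcap_m grid k m).
  apply: (@nonincreasing_cvg_mu _ _ _ (D x)) => //.
  - by rewrite (le_lt_trans (probability_le1 _ _)) ?ltry//; exact: measurable_grid.
  - by move=> m; exact: measurable_grid.
  - exact: grid_nonincreasing.
rewrite -(cvg_lim (@ereal_hausdorff _) cv); apply: lime_ge.
  by apply/cvg_ex; eexists; exact: cv.
by apply: nearW => m; rewrite PrE ?lee_fin; [exact: Pr_grid | exact: measurable_grid].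
Qed.

End confinement.

(** * Exploration: the sausage gains volume at a linear rate *)

(** A dense sequence instead of a countable dense set; the point x rules out
    the empty space. *)
Lemma separable_seq (R : realType) (X : completeMetricType R) (x : X) :
  separable X -> exists q : nat -> X, forall (dl : R) y, 0 < dl ->
    exists i, mdist (q i) y < dl.
Proof.
move=> [Q cQ dQ].
have dense_ball dl y : 0 < dl -> exists2 z, Q z & mdist z y < dl.
  move=> dl0; have := dQ (ball y dl)°.
  case; [|exact: open_interior|].
    by exists y; rewrite /interior; exact: nbhsx_ballx.
  move=> z [/interior_subset + Qz]; rewrite ballEmdist /= metric_sym => zy.
  by exists z.
case/pfcard_geP : cQ => [Q0|[q]].
  by have [z] := dense_ball 1 x ltr01; rewrite Q0.
exists q => dl y /(dense_ball _ y)[z Qz zy].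
by have [i _ qi] := @surj _ _ _ _ q z Qz; exists i; rewrite qi.
Qed.

Lemma measurable_constant_set d (T : measurableType d) (P : Prop) :
  measurable [set _ : T | P].
Proof.
have [p|np] := pselect P.
  by rewrite (_ : mkset _ = setT)//; apply/seteqP; split.
by rewrite (_ : mkset _ = set0)//; apply/seteqP; split.
Qed.

Section exploration.
Context {R : realType} {X : completeMetricType R}.
Context {mu : {measure set (borel X) -> \bar R}} {h : R -> X -> X -> R}.
Context {d : measure_display} {W : measurableType d} (D : diffusion mu h W).
Context (beta c C c1 : R).
Hypothesis K : kernel_bounds mu h beta c C c1.
Notation V x r := (fine (vol mu x r)).

Variables (q : nat -> X) (dl : R).
Hypothesis dl0 : 0 < dl.
Hypothesis q_dense : forall y, exists i, mdist (q i) y < dl.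

(** Rounding points to a dense sequence makes the history of the path take
    countably many values, so the Markov property for product events can be
    summed over histories. *)
Definition cell (y : X) : nat := ex_minn (q_dense y).

Lemma cellP y : mdist (q (cell y)) y < dl.
Proof. by rewrite /cell; case: ex_minnP. Qed.

Lemma measurable_cell i : measurable ([set y | cell y = i] : set (borel X)).
Proof.
suff -> : [set y | cell y = i] = seqDU (fun j => ball (q j) dl) i.
  by apply: seqDU_measurable => j; exact: borel_ball.
rewrite /seqDU; apply/seteqP; split => y /=.
  rewrite /cell; case: ex_minnP => m my mmin <-.
  split; first by rewrite ballEmdist.
rewrite -(bigcup_mkord _ (fun j => ball (q j) dl)) => -[j /= jm]; rewrite ballEmdist /= => /mmin; rewrite leqNgt jm//.
rewrite -(bigcup_mkord _ (fun j => ball (q j) dl)) => -[qy nqy]; rewrite /cell; case: ex_minnP => m my mmin.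
rewrite ballEmdist /= in qy.
apply/eqP; rewrite eqn_leq mmin//= leqNgt; apply/negP => mi.
by apply: nqy; exists m => //=; rewrite ballEmdist.
Qed.

(** The radius is 3 dl because of the rounding: a point at distance at least 3
    dl from a site lies in a cell whose centre is at distance at least 2 dl
    from that site, and then the balls of radius dl are disjoint. *)
Definition near_sites (l : seq nat) : set X :=
  \big[setU/set0]_(s <- l) ball (q s) (3 * dl).

Definition packed_vol (l : seq nat) : R := \sum_(s <- l) V (q s) dl.

Definition explore (y : X) (l : seq nat) : seq nat :=
  if `[< near_sites l y >] then l else cell y :: l.

Lemma near_sitesP l y :
  near_sites l y <-> exists2 s, s \in l & mdist (q s) y < 3 * dl.
Proof.
rewrite /near_sites -bigcup_seq; split => -[s /= sl].
  by rewrite ballEmdist /= => sy; exists s.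
by exists s => //; rewrite ballEmdist.
Qed.

Lemma measurable_near_sites l : measurable (near_sites l : set (borel X)).
Proof. by apply: bigsetU_measurable => s _; exact: borel_ball. Qed.

Lemma mu_near_sites_le l : (mu (near_sites l) <= (doubling_const beta c C 3 * packed_vol l)%:E)%E.
Proof.
rewrite /near_sites /packed_vol; elim: l => [|s l IH].
  by rewrite !big_nil measure0 mulr0.
rewrite !big_cons mulrDr EFinD.
apply: le_trans (measureU2 _ _ _) _; first exact: borel_ball.
  exact: measurable_near_sites.
apply: leeD IH; rewrite [leLHS](kb_vol K) ?mulr_gt0// lee_fin.
exact: (doubling D K).
Qed.

Lemma measurable_explore l l' :
  measurable ([set y | explore y l' = l] : set (borel X)).
Proof.
have mN := measurable_near_sites l'.
have -> : [set y | explore y l' = l] =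
    (near_sites l' `&` [set _ | l' = l]) `|`
    (~` near_sites l' `&` [set y | cell y :: l' = l]).
  apply/seteqP; split => y /=; rewrite /explore; case: ifPn => /asboolP; tauto.
apply: measurableU; apply: measurableI; [exact: mN | | exact: measurableC |].
  exact: measurable_constant_set.
rewrite (_ : mkset _ = [set y | cell y = head 0%N l] `&`
    [set _ | l = head 0%N l :: l']).
  apply: measurableI; [exact: measurable_cell | exact: measurable_constant_set].
apply/seteqP; split => y /=; first by move=> <-.
by case=> -> <-.
Qed.

Variables (x : X) (t : R).
Hypothesis t0 : 0 < t.
Let tau := t `^ beta.
Let tau0 : 0 < tau. Proof. exact: powR_gt0. Qed.

(** The list of sites is kept separated by construction; it grows exactly when
    the observation falls outside [near_sites]. *)
Fixpoint sites (k : nat) (w : W) : seq nat :=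
  if k is j.+1 then explore (traj D (j%:R * tau + tau) w) (sites j w) else [::].

Let time_ge0 k : 0 <= k%:R * tau. Proof. by rewrite mulr_ge0// ltW. Qed.

Let timeS k : k.+1%:R * tau = k%:R * tau + tau.
Proof. by rewrite -natr1 mulrDl mul1r. Qed.

(** Closure of the past under countable unions, used with the union running
    over all possible histories. *)
Lemma past_bigcup (I : countType) (P : I -> Prop) s (F : I -> set W) :
  (forall i, past D s (F i)) -> past D s (\bigcup_(i in P) F i).
Proof.
move=> pF; rewrite bigcup_mkcond.
apply: (@countable_bigcupT_measurable _ (g_sigma_algebraType _)) => //.
by move=> i; case: ifP => _; [exact: pF | exact: measurable0].
Qed.

Lemma past_sites k l : past D (k%:R * tau) [set w | sites k w = l].
Proof.
elim: k l => [|k IH] l /=.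
  exact: (@measurable_constant_set _ (g_sigma_algebraType _)).
rewrite (_ : mkset _ = \bigcup_l' ([set w | sites k w = l'] `&`
    traj D (k%:R * tau + tau) @^-1` [set y | explore y l' = l])).
  apply: past_bigcup => l'; apply: pastI.
    by apply: past_mono (IH l'); rewrite timeS lerDl ltW.
  apply: past_traj; last exact: measurable_explore.
  by rewrite timeS lexx addr_ge0// ltW.
by apply/seteqP; split => w /=; [move=> e; exists (sites k w) | case=> _ _ [<-]].
Qed.

Lemma sites_separated k w :
  pairwise (fun i j => 2 * dl <= mdist (q i) (q j)) (sites k w).
Proof.
elim: k => //= k IH; rewrite /explore; case: ifPn => // /asboolP nn /=.
rewrite IH andbT; apply/allP => s sl; set y := traj D _ w in nn *.
rewrite leNgt; apply/negP => close; apply: nn; apply/near_sitesP; exists s => //.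
have := metric_triangle (q s) (q (cell y)) y; have := cellP y.
by rewrite (metric_sym (q s) (q (cell y))); lra.
Qed.

Lemma sites_visited k w s : s \in sites k w ->
  exists2 j, (j <= k)%N & mdist (q s) (traj D (j%:R * tau) w) < dl.
Proof.
elim: k => //= k IH; rewrite /explore; case: ifPn => _.
  by move=> /IH[j jk]; exists j => //; exact: leqW.
rewrite inE => /orP[/eqP ->|/IH[j jk]]; last by exists j => //; exact: leqW.
by exists k.+1 => //; rewrite timeS; exact: cellP.
Qed.

Lemma size_sites k w : (size (sites k w) <= k)%N.
Proof. by elim: k => //= k IH; rewrite /explore; case: ifPn => _ //=; lia. Qed.

Lemma packed_vol_mono k w : packed_vol (sites k w) <= packed_vol (sites k.+1 w).
Proof.
rewrite /= /explore; case: ifPn => // _; rewrite /packed_vol big_cons lerDr.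
by rewrite ltW// (V_gt0 K).
Qed.

Lemma packed_vol_size l : (size l)%:R * (c1 * dl) <= packed_vol l.
Proof.
rewrite /packed_vol; elim: l => [|s l IH]; first by rewrite big_nil mul0r.
rewrite big_cons -natr1 mulrDl mul1r addrC lerD//.
exact: (kb_lin K).
Qed.

Lemma mu_packed l :
  pairwise (fun i j => 2 * dl <= mdist (q i) (q j)) l ->
  mu (\big[setU/set0]_(s <- l) ball (q s) dl) = (packed_vol l)%:E.
Proof.
rewrite /packed_vol; elim: l => [|s l IH] /=; first by rewrite !big_nil measure0.
move=> /andP[/allP sep /IH {}IH]; rewrite !big_cons measureU.
- by rewrite EFinD -IH -(kb_vol K (q s) dl0).
- exact: borel_ball.
- by apply: bigsetU_measurable => i _; exact: borel_ball.
apply/seteqP; split => // y [/=]; rewrite ballEmdist /= => sy.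
rewrite -bigcup_seq => -[i /= /sep si]; rewrite ballEmdist /= => iy.
by have := metric_triangle (q s) y (q i); rewrite (metric_sym y); lra.
Qed.

(** The packed balls are disjoint and contained in the sausage, since each
    site is within dl of a visited point. *)
Lemma sausage_ge k T w : k%:R * tau <= T ->
  ((packed_vol (sites k w))%:E <= mu (sausage D (2 * dl) T w))%E.
Proof.
move=> kT; rewrite -mu_packed; last exact: sites_separated.
apply: le_measure; rewrite ?inE.
- by apply: bigsetU_measurable => i _; exact: borel_ball.
- apply: sub_sigma_algebra; apply: bigcup_open => z _.
  exact: open_metric_ball.
rewrite -bigcup_seq => y [s /= /sites_visited[j jk sj]].
rewrite ballEmdist /= => sy; exists (traj D (j%:R * tau) w).
  exists (j%:R * tau) => //=; rewrite in_itv /= time_ge0 (le_trans _ kT)//.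
  by rewrite ler_wpM2r ?ler_nat// ltW.
rewrite ballEmdist /=.
have := metric_triangle (traj D (j%:R * tau) w) (q s) y.
by rewrite (metric_sym _ (q s)); lra.
Qed.

Variables (T v nu : R).
Hypothesis spread : forall z, ball x T z ->
  C * (doubling_const beta c C 3 * v) <= V z t / 2.
Hypothesis nu0 : 0 < nu.
Let th := expR (- (nu * (c1 * dl))).

Let th01 : 0 <= th <= 1.
Proof.
rewrite expR_ge0 -expR0 ler_expR oppr_le0 mulr_ge0 ?(ltW nu0)//.
by rewrite mulr_ge0// ltW// (kb_c1 K).
Qed.

(** The situation in which the next observation is likely to be new: little
    volume packed so far, and a position where balls of radius t are known to
    be large. *)
Definition good (k : nat) : set W :=
  [set w | packed_vol (sites k w) <= v] `&`
  \bigcap_(j in [set j | (j <= k)%N]) traj D (j%:R * tau) @^-1` ball x T.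

Lemma past_sites_pred k (P : seq nat -> Prop) :
  past D (k%:R * tau) [set w | P (sites k w)].
Proof.
rewrite (_ : mkset _ = \bigcup_(l in P) [set w | sites k w = l]).
  by apply: past_bigcup => l; exact: past_sites.
by apply/seteqP; split => w /=; [exists (sites k w) | case=> l Pl ->].
Qed.

Lemma past_good k : past D (k%:R * tau) (good k).
Proof.
apply: pastI; first exact: (past_sites_pred (fun l => packed_vol l <= v)).
apply: (@bigcap_measurable _ (g_sigma_algebraType _)); first by exists 0%N.
move=> j /= jk; apply: past_traj; last exact: borel_ball.
by rewrite time_ge0 ler_wpM2r ?ler_nat// ltW.
Qed.

Definition revisit (k : nat) : set W :=
  [set w | near_sites (sites k w) (traj D (k%:R * tau + tau) w)].

Lemma past_revisit k : past D (k.+1%:R * tau) (revisit k).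
Proof.
rewrite (_ : revisit k = \bigcup_l ([set w | sites k w = l] `&`
    traj D (k%:R * tau + tau) @^-1` near_sites l)).
  apply: past_bigcup => l; apply: pastI.
    by have := @past_sites k l; apply: past_mono; rewrite timeS lerDl ltW.
  apply: past_traj; last exact: measurable_near_sites.
  by rewrite timeS lexx addr_ge0// ltW.
by apply/seteqP; split => w /=; [exists (sites k w) | case=> _ _ [<-]].
Qed.

(** Condition on the value l of the list of sites. The kernel at time t^beta
    is at most C / V(z,t), the set [near_sites l] has measure at most a
    constant times the packed volume, and [spread] says that the product is at
    most 1/2. *)
Lemma Pr_revisit k F : past D (k%:R * tau) F -> F `<=` good k ->
  Pr D x (F `&` revisit k) <= Pr D x F / 2.
Proof.
move=> pF Fg; pose E n := F `&` [set w | pickle (sites k w) = n].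
have pE n : past D (k%:R * tau) (E n).
  by apply: pastI => //; exact: (past_sites_pred (fun l => pickle l = n)).
have mF := past_measurable pF; have mr := past_measurable (@past_revisit k).
have mE n := past_measurable (pE n).
(* The histories partition F. *)
have tE : trivIset setT E.
  apply/trivIsetP => i j _ _ /eqP ij; apply/seteqP; split => //.
  by move=> w [[_ /= wi] [_ /= wj]]; apply: ij; rewrite -wi -wj.
have FE : F = \bigcup_n E n.
  by apply/seteqP; split => w; [move=> Fw; exists (pickle (sites k w)) | case=> n _ []].
have half n : (D x (E n `&` revisit k) <= (2^-1)%:E * D x (E n))%E.
  have [->|/set0P[w0 [Fw0 /= <-]]] := eqVneq (E n) set0.
    by rewrite set0I measure0 mule0.
  set l := sites k w0.
  have -> : E (pickle l) `&` revisit k =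
      E (pickle l) `&` traj D (k%:R * tau + tau) @^-1` near_sites l.
    by apply/seteqP; split => w [[Fw /= wl]] /= r; (split; first by split);
      move: r; rewrite /revisit /= (pcan_inj pickleK wl).
  apply: markov_le => //; first exact: (kernel_ge0 K).
    exact: measurable_near_sites.
  move=> w [Fw _]; apply: le_trans (transition_le_vol K _ t0 _ (mu_near_sites_le _)) _.
    exact: measurable_near_sites.
  have [_ /(_ k (leqnn k)) /= wT] := Fg _ Fw.
  have [/= lv _] := Fg _ Fw0.
  have vz := V_gt0 K (traj D (k%:R * tau) w) t0.
  rewrite lee_fin mulrAC ler_pdivrMr// mulrC [_^-1 * _]mulrC.
  apply: le_trans (spread wT); rewrite mulrC ler_wpM2l ?(ltW (kb_C K))//.
  by rewrite ler_wpM2l// ltW// (doubling_const_gt0 K).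
rewrite -lee_fin mulrC EFinM -!PrE//; last exact: measurableI.
rewrite FE setI_bigcupl measure_bigcup//; last 2 first.
- by move=> n _; exact: measurableI.
- by apply: trivIset_setIr.
rewrite measure_bigcup// -nneseriesZl//.
by apply: lee_nneseries => n _ *; [exact: measure_ge0 | exact: half].
Qed.

(** The expectation of th to the number of sites, on the good event, is the
    sum over j of th^j times the probability of [level k j]. *)
Definition level (k j : nat) : set W :=
  good k `&` [set w | size (sites k w) = j].

Lemma past_level k j : past D (k%:R * tau) (level k j).
Proof.
apply: pastI; first exact: past_good.
exact: (past_sites_pred (fun l => size l = j)).
Qed.

Lemma measurable_level k j : measurable (level k j).
Proof. exact: past_measurable (@past_level k j). Qed.

Lemma measurable_revisit k : measurable (revisit k).
Proof. exact: past_measurable (@past_revisit k). Qed.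

Lemma good_decr k : good k.+1 `<=` good k.
Proof.
move=> w [/= lv inT]; split => /=; first exact: le_trans (packed_vol_mono k w) lv.
by move=> j /= jk; apply: inT; exact: leqW.
Qed.

Lemma level_step k j : level k.+1 j `<=`
  (level k j `&` revisit k) `|`
  (if j is i.+1 then level k i `\` revisit k else set0).
Proof.
move=> w [/[dup] /good_decr gk _ /=]; rewrite /explore.
case: ifPn => /asboolP rv; first by left.
by case: j => // j [sj]; right.
Qed.

(** To have j sites after the next observation, either there were j and the
    observation was a revisit, or there were j - 1 and it was not. *)
Lemma Pr_level_step k j : Pr D x (level k.+1 j) <=
  Pr D x (level k j `&` revisit k) +
  (if j is i.+1 then Pr D x (level k i) - Pr D x (level k i `&` revisit k) else 0).
Proof.
have mr := measurable_revisit k.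
have mI i : measurable (level k i `&` revisit k).
  by apply: measurableI => //; exact: measurable_level.
have mD i : measurable (level k i `\` revisit k).
  by apply: measurableD => //; exact: measurable_level.
have st := @level_step k j; have mL := measurable_level k.+1 j.
case: j st mL => [|j] st mL; first by rewrite addr0 le_Pr// => w /st[].
have -> : Pr D x (level k j) - Pr D x (level k j `&` revisit k) =
    Pr D x (level k j `\` revisit k).
  by rewrite (PrID D x (measurable_level k j) mr) addrAC subrr add0r.
have mU := measurableU _ _ (mI j.+1) (mD j).
apply: le_trans (le_Pr D x mL mU st) _.
rewrite -lee_fin EFinD -!PrE//; exact: measureU2.
Qed.

(** Each observation multiplies the weight by 1 after a revisit and by th
    otherwise. A revisit has probability at most 1/2, which bounds the mean
    factor by (1 + th) / 2. *)
Lemma level_sum n k :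
  \sum_(j < n.+1) th ^+ j * Pr D x (level k j) <= ((1 + th) / 2) ^+ k.
Proof.
have /andP[th0 th1] := th01.
have P0 A : 0 <= Pr D x A by exact: Pr_ge0.
elim: k => [|k IH].
  rewrite expr0 big_ord_recl big1 => [|i _].
    by rewrite expr0 mul1r addr0 Pr_le1//; exact: measurable_level.
  rewrite (_ : level 0 _ = set0) ?/Pr ?measure0 ?mulr0//.
  by apply/seteqP; split => // w [].
pose p j := Pr D x (level k j); pose b j := Pr D x (level k j `&` revisit k).
have bp j : b j <= p j / 2.
  by apply: Pr_revisit; [exact: past_level | move=> w []].
have p0 j : 0 <= p j by exact: P0.
rewrite exprS.
(* Reindex the non-revisits by the previous number of sites; the first term
   has none. *)
apply: (@le_trans _ _ (\sum_(j < n.+1) th ^+ j * b j +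
                       \sum_(j < n) th ^+ j.+1 * (p j - b j))).
  rewrite !big_ord_recl /= !expr0 !mul1r -addrA lerD//.
    by have := Pr_level_step k 0; rewrite addr0.
  rewrite -big_split /=; apply: ler_sum => i _; rewrite -mulrDr.
  by rewrite ler_wpM2l ?exprn_ge0//; exact: (Pr_level_step k i.+1).
apply: (@le_trans _ _ (\sum_(j < n.+1) th ^+ j * (b j + th * (p j - b j)))).
  under [leRHS]eq_bigr do rewrite mulrDr mulrA -exprSr.
  rewrite big_split /= lerD2l [leRHS]big_ord_recr /= lerDl.
  by rewrite mulr_ge0 ?exprn_ge0// subr_ge0; have := bp n; have := p0 n; lra.
apply: le_trans (ler_wpM2l _ IH); last by lra.
rewrite mulr_sumr; apply: ler_sum => i _; rewrite [leRHS]mulrCA.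
rewrite ler_wpM2l ?exprn_ge0//; have := bp i; rewrite -/(p i).
by have := p0 i; nra.
Qed.

(** On its complement (V2) controls the volumes around all the observed
    points. *)
Definition escapes (n : nat) : set W :=
  \bigcup_(j in [set j | (j <= n)%N]) traj D (j%:R * tau) @^-1` (~` ball x T).

Lemma measurable_escapes n : measurable (escapes n).
Proof.
apply: bigcup_measurable => j _; rewrite -[X in measurable X]setTI.
apply: (traj_measurable D) => //; apply: measurableC; exact: borel_ball.
Qed.

(** At any time up to T, the length scale is at most T^(1/beta), and the
    profile of T / T^(1/beta) is T. *)
Lemma Pr_escapes n : 0 < T -> n%:R * tau <= T ->
  Pr D x (escapes n) <= n%:R * (tail_const beta c C * expR (- (c / 2 * T))).
Proof.
move=> T0; elim: n => [|n IH] nT.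
  rewrite mul0r -lee_fin -PrE; last exact: measurable_escapes.
  have m0 : measurable (traj D 0 @^-1` [set x]).
    apply: measurable_traj => //.
    exact: measurable_point.
  have z0 : D x (~` (traj D 0 @^-1` [set x])) = 0%E.
    by rewrite probability_setC// [X in (1 - X)%E]traj_start subee.
  rewrite (subset_measure0 _ _ _ z0)//; [exact: measurable_escapes|exact: measurableC|].
  move=> w [j /=]; rewrite leqn0 => /eqP ->; rewrite mul0r => nx xE.
  by apply: nx; rewrite xE; exact: ballxx.
have nT' : n%:R * tau <= T.
  by apply: le_trans nT; rewrite ler_wpM2r ?ler_nat// ltW.
set a := tail_const _ _ _ * _.
pose B := traj D (n.+1%:R * tau) @^-1` (~` ball x T).
have mB : measurable B.
  apply: measurable_traj => //.
  by apply: measurableC; exact: borel_ball.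
have BE : (D x B <= a%:E)%E.
  have n0 : 0 < n.+1%:R * tau by rewrite mulr_gt0.
  rewrite /B law_traj//; last by apply: measurableC; exact: borel_ball.
  have b1 := kb_beta K.
  have bN : beta != 0 by rewrite gt_eqF// (lt_trans _ b1).
  have b1N : beta - 1 != 0 by rewrite subr_eq0 gt_eqF.
  have [r0 rE] := root_time K T0.
  (* Scale T^(1/beta) and ratio T^(1 - 1/beta), whose profile is T. *)
  have -> : a = tail_const beta c C * expR (- (c / 2 * profile beta (T `^ (1 - beta^-1)))).
    rewrite /a /profile -powRrM (_ : (1 - beta^-1) * _ = 1) ?powRr1 ?ltW//.
    by field; rewrite bN b1N.
  apply: (transition_tail_time D K n0 r0); [by rewrite rE | exact: powR_ge0 | |].
    by apply: measurableC; exact: borel_ball.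
  move=> y; rewrite -powRD; last by apply/implyP => _; rewrite gt_eqF.
  rewrite subrK (powRr1 (ltW T0)) ballEmdist => /negP.
  by rewrite -leNgt.
rewrite -natr1 mulrDl mul1r.
have FU : escapes n.+1 `<=` escapes n `|` B.
  move=> w [j /= jn xj]; have [je|je] := eqVneq j n.+1.
    by right; rewrite /B -je.
  by left; exists j => //=; rewrite -ltnS ltn_neqAle je.
have mU := measurableU _ _ (measurable_escapes n) mB.
apply: le_trans (le_Pr D x (measurable_escapes n.+1) mU FU) _.
apply: le_trans (lerD (IH nT') (_ : Pr D x B <= a)); last first.
  by rewrite -lee_fin -PrE.
by rewrite -lee_fin EFinD -!PrE//; [exact: measureU2 (measurable_escapes n) mB | exact: measurable_escapes].
Qed.

Let laplace_mono (a : R) (m : \bar R) : (a%:E <= m)%E ->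
  (expeR (- (nu%:E * m)) <= (expR (- (nu * a)))%:E)%E.
Proof.
move=> am; rewrite -[leRHS]/(expeR (- (nu * a))%:E) lee_expeR EFinN leeN2 EFinM.
by apply: lee_wpmul2l => //; rewrite lee_fin ltW.
Qed.

(** Three cases: the path escapes, or the packed volume exceeds v, or there
    are j sites, each contributing a volume of at least c1 dl. *)
Lemma sausage_laplace_le n : 0 < T -> n%:R * tau <= T ->
  (sausage_laplace D (2 * dl) nu x T <=
   (n%:R * (tail_const beta c C * expR (- (c / 2 * T))) + expR (- (nu * v))
    + ((1 + th) / 2) ^+ n)%:E)%E.
Proof.
move=> T0 nT; have /andP[th0 th1] := th01.
pose f1 w : \bar R := (\1_(escapes n) w)%:E.
pose f2 w : \bar R := (\sum_(j < n.+1) (th ^+ j)%:E * (\1_(level n j) w)%:E)%E.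
pose e : R := expR (- (nu * v)).
have f10 w : (0 <= f1 w)%E by rewrite lee_fin.
have ind0 j w : (0 <= (th ^+ j)%:E * (\1_(level n j) w)%:E)%E.
  by rewrite mule_ge0// lee_fin exprn_ge0.
have f20 w : (0 <= f2 w)%E by apply: sume_ge0.
have e0 : (0 <= e%:E)%E by rewrite lee_fin expR_ge0.
have mind A : measurable A -> measurable_fun setT (fun w : W => (\1_A w)%:E : \bar R).
  by move=> mA; apply/measurable_EFinP; exact: measurable_indic.
have mf1 : measurable_fun setT f1 by apply: mind; exact: measurable_escapes.
have mi j : measurable_fun setT (fun w => ((th ^+ j)%:E * (\1_(level n j) w)%:E)%E).
  by apply: measurable_funeM; apply: mind; exact: measurable_level.
have mf2 : measurable_fun setT f2 by apply: emeasurable_sum => j; exact: mi.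
apply: (@le_trans _ _ (\int[D x]_w (f1 w + e%:E + f2 w))%E).
  apply: ge0_le_integral_nonmeas => w _; first exact: expeR_ge0.
  set m := mu _.
  have [fw|nf] := pselect (escapes n w).
    apply: (@le_trans _ _ (f1 w)); last by rewrite -addeA leeDl// adde_ge0.
    rewrite /f1 indicE mem_set//.
    rewrite -expeR0 lee_expeR oppe_le0; apply: mule_ge0; last exact: measure_ge0.
    by rewrite lee_fin ltW.
  have vm : ((packed_vol (sites n w))%:E <= m)%E by exact: sausage_ge.
  have [lv|vl] := leP (packed_vol (sites n w)) v; last first.
    apply: (@le_trans _ _ e%:E); last by rewrite addeAC leeDr// adde_ge0.
    apply: laplace_mono; apply: le_trans vm; rewrite lee_fin; exact: ltW.
  apply: (@le_trans _ _ (f2 w)); last by rewrite leeDr// adde_ge0.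
  have sn : (size (sites n w) < n.+1)%N by rewrite ltnS; exact: size_sites.
  rewrite /f2 (bigD1 (Ordinal sn))//= -[leLHS]adde0; apply: leeD; last first.
    by apply: sume_ge0.
  rewrite indicE mem_set ?mule1; last first.
    split => //; split => // j /= jn.
    by apply: contrapT => nb; apply: nf; exists j.
  apply: le_trans (laplace_mono vm) _.
  rewrite lee_fin /th -expRM_natl ler_expR mulrN lerN2 mulrCA.
  by rewrite ler_wpM2l ?(ltW nu0)//; exact: packed_vol_size.
rewrite ge0_integralD//; last 2 first.
- by move=> w _; exact: adde_ge0.
- by apply: emeasurable_funD => //; exact: measurable_cst.
rewrite ge0_integralD// integral_cst// integral_indic//; last exact: measurable_escapes.
rewrite setIT [X in (_ * X)%E]probability_setT mule1 !EFinD.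
apply: leeD.
  apply: leeD => //; rewrite [leLHS](PrE D x (measurable_escapes n)) lee_fin.
  exact: Pr_escapes.
rewrite ge0_integral_sum//.
apply: le_trans (_ : _ <= (\sum_(j < n.+1) th ^+ j * Pr D x (level n j))%:E)%E _; last first.
  by rewrite lee_fin; exact: level_sum.
rewrite -sumEFin; apply: lee_sum => j _.
rewrite ge0_integralZl//; last 2 first.
- by apply: mind; exact: measurable_level.
- by rewrite lee_fin exprn_ge0.
rewrite integral_indic//; last exact: measurable_level.
rewrite setIT EFinM [X in (_ * X <= _)%E](PrE D x (measurable_level n j)).
exact: lexx.
Qed.

End exploration.

(** * The two bounds on the Laplace transform *)

(** (V1) supplies finiteness and the linear lower bound of volumes; the rest
    is the change of time variable. *)
Lemma kernel_bounds_of_GE (R : realType) (X : completeMetricType R)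
    (mu : {measure set (borel X) -> \bar R}) (h : R -> X -> X -> R) (beta : R) :
  1 < beta ->
  (forall t : R, 0 < t ->
    measurable_fun setT (fun z : borel X * borel X => h t z.1 z.2)) ->
  V1 mu -> GE mu beta h -> exists c C c1, kernel_bounds mu h beta c C c1.
Proof.
move=> b1 hm [c1 c10 hV1] [c [C [c0 C0 hGE]]].
have b0 : 0 < beta by exact: lt_trans b1.
have lo x (r : R) : 0 < r -> ((c1 * r)%:E < vol mu x r)%E.
  by move=> /hV1[+ _] => /lt_le_trans; apply; apply: ereal_inf_lbound; exists x.
have fin x (r : R) : 0 < r -> vol mu x r = (fine (vol mu x r))%:E.
  move=> r0; rewrite fineK// fin_numElt (lt_trans _ (lo x r r0)) ?ltNyr//=.
  have [_] := hV1 r r0; apply: le_lt_trans.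
  by apply: ereal_sup_ubound; exists x.
exists c, C, c1; split => //.
  by move=> x r r0; rewrite -lee_fin -fin// ltW// lo.
move=> x y r r0; have := hGE x y (r `^ beta) (powR_gt0 beta r0); cbv zeta.
rewrite -powRrM divff ?gt_eqF// (powRr1 (ltW r0)) /profile.
suff -> : mdist x y `^ beta / r `^ beta = (mdist x y / r) `^ beta.
  by rewrite -powRrM.
have dr0 : 0 <= mdist x y / r by rewrite divr_ge0 ?mdist_ge0// ltW.
rewrite -{1}(divfK (lt0r_neq0 r0) (mdist x y)) powRM ?(ltW r0)//.
by rewrite mulfK// gt_eqF// powR_gt0.
Qed.

Section bounds.
Context {R : realType} {X : completeMetricType R}.
Context {mu : {measure set (borel X) -> \bar R}} {h : R -> X -> X -> R}.
Context {d : measure_display} {W : measurableType d} (D : diffusion mu h W).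
Context (beta c C c1 : R).
Hypothesis K : kernel_bounds mu h beta c C c1.
Notation V x r := (fine (vol mu x r)).

Let beta0 : 0 < beta. Proof. exact: lt_trans (kb_beta K). Qed.

(** Confinement in B(x,t) with steps of length (t/A)^beta, where A is taken so
    large that the escape probability of a step is at most half the
    probability of return. The number of steps is A^beta V(x,t) up to
    rounding. *)
Lemma sausage_laplace_ge x (eps nu : R) : 0 < eps -> 0 < nu ->
  exists2 C2, 0 < C2 & forall t, eps <= t -> 1 <= V x t ->
    ((expR (- (C2 * V x t)))%:E <=
     sausage_laplace D eps nu x (t `^ beta * V x t))%E.
Proof.
move=> eps0 nu0; pose rr := return_rate beta c C.
have rr0 : 0 < rr by exact: return_rate_gt0 K.
have c20 : 0 < c / 2 by rewrite divr_gt0// (kb_c K).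
have rr20 : 0 < rr / 2 by rewrite divr_gt0.
have [M M1 hM] := expR_small (tail_const_gt0 K) c20 rr20.
pose A := 1 + M.
have A1 : 1 <= A by rewrite lerDl (le_trans _ M1).
have A0 : 0 < A by exact: lt_le_trans A1.
have bA : tail_const beta c C * expR (- (c / 2 * profile beta (A - 1))) <= rr / 2.
  by apply: hM; rewrite /A addrAC subrr add0r; exact: profile_ge_id K _ M1.
(* The logarithmic cost of one step. *)
pose g := `|ln (rr / 2)|.
have d20 := doubling_const_gt0 K 2.
exists (nu * doubling_const beta c C 2 + g * (A `^ beta + 1)).
  apply: ltr_pwDl; first exact: mulr_gt0.
  by apply: mulr_ge0; [exact: normr_ge0 | apply: addr_ge0 => //; exact: powR_ge0].
move=> t et Vge1; have t0 : 0 < t by exact: lt_le_trans et.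
set T := t `^ beta * V x t.
have r0 : 0 < t / A by rewrite divr_gt0.
pose tau := (t / A) `^ beta.
have tau0 : 0 < tau by rewrite powR_gt0.
have TE : T / tau = A `^ beta * V x t.
  have tA : t `^ beta = tau * A `^ beta.
    by rewrite /tau -powRM ?ltW// mulfVK// gt_eqF.
  by rewrite /T tA; field; rewrite gt_eqF.
pose k := (Num.truncn (T / tau)).+1.
have T0 : 0 <= T / tau by rewrite TE mulr_ge0 ?powR_ge0// (le_trans _ Vge1).
have /andP[kl ku] := truncn_itv T0.
have [G [mG PG hG]] := confinement D K x r0 A1 bA k.
have kT : T <= k%:R * tau by rewrite -ler_pdivrMr// ltW.
have sub w : G w -> (mu (sausage D eps T w) <= (doubling_const beta c C 2 * V x t)%:E)%E.
  move=> Gw; apply: (@le_trans _ _ (mu (ball x (2 * t)))).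
    apply: le_measure; rewrite ?inE.
    - apply: sub_sigma_algebra; apply: bigcup_open => z _.
      exact: open_metric_ball.
    - exact: borel_ball.
    move=> y [_ [s /= sT <-]]; rewrite !ballEmdist /= => zy.
    have : mdist x (traj D s w) <= A * (t / A).
      apply: hG => //; move: sT; rewrite in_itv /= => /andP[-> sT].
      exact: le_trans kT.
    have -> : A * (t / A) = t by field; rewrite gt_eqF.
    move=> xz; apply: le_lt_trans (metric_triangle x (traj D s w) y) _.
    by rewrite mulr_natl mulr2n ler_ltD// (lt_le_trans zy).
  rewrite [leLHS](kb_vol K) ?mulr_gt0// lee_fin.
  exact: (doubling D K).
pose a := expR (- (nu * (doubling_const beta c C 2 * V x t))).
apply: (@le_trans _ _ (\int[D x]_w (a%:E * (\1_G w)%:E))%E); last first.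
  apply: ge0_le_integral_nonmeas => w _.
    by rewrite mule_ge0// lee_fin// expR_ge0.
  rewrite indicE; have [Gw|nG] := pselect (G w); last first.
    by rewrite memNset// mule0 expeR_ge0.
  rewrite mem_set// mule1 -[a%:E]/(expeR (- (nu * _))%:E) lee_expeR.
  rewrite EFinN leeN2 EFinM; apply: lee_wpmul2l; last exact: sub.
  by rewrite lee_fin ltW.
rewrite ge0_integralZl//; last 2 first.
- by apply/measurable_EFinP; exact: measurable_indic.
- by rewrite lee_fin expR_ge0.
rewrite integral_indic// setIT [X in (_ <= _ * X)%E](PrE D x mG) -EFinM lee_fin.
rewrite mulrDl opprD expRD -mulrA ler_pM ?expR_ge0//.
apply: le_trans PG; rewrite -/rr.
have rE : rr / 2 = expR (ln (rr / 2)) by rewrite lnK// posrE divr_gt0.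
rewrite rE -expRM_natl ler_expR.
have lng : - g <= ln (rr / 2) by rewrite lerNl /g -normrN ler_norm.
have kV : k%:R <= (A `^ beta + 1) * V x t.
  by rewrite /k -natr1 mulrDl mul1r -TE lerD.
apply: le_trans (ler_wpM2l (ler0n R k) lng).
rewrite mulrN lerN2 -(mulrA g) (mulrC k%:R); apply: ler_wpM2l kV.
exact: normr_ge0.
Qed.

Lemma volume_lower_of_V2 x : V2 mu beta -> exists2 c2, 0 < c2 & \forall t \near +oo,
  forall z, ball x (t `^ beta * V x t) z -> c2 * V x t <= V z t.
Proof.
move=> /(_ x); rewrite limf_einfE => /ereal_sup_gt[_ [F nF <-]].
set e := ereal_inf _ => e0.
have [c2 c20 ce] : exists2 c2, 0 < c2 & (c2%:E <= e)%E.
  case: (e) e0 => [r| |] //; first by rewrite lte_fin => r0; exists r.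
  by exists 1 => //; rewrite leey.
exists c2 => //; near=> t => z xz.
have t0 : 0 < t by near: t; exact: nbhs_pinfty_gt.
have Ft : F t by near: t.
have v0 := V_gt0 K x t0.
rewrite -ler_pdivlMr// -lee_fin; apply: (le_trans ce).
apply: (@le_trans _ _ ((vol mu x t)^-1 * vol mu z t)%E); last first.
  by rewrite (kb_vol K x t0) (kb_vol K z t0) /= inver gt_eqF//= -EFinM mulrC.
apply: (@le_trans _ _ ((vol mu x t)^-1 *
    ereal_inf [set vol mu y t | y in ball x (t `^ beta * V x t)])%E).
  by apply: ereal_inf_lbound; exists t.
apply: lee_wpmul2l; first by rewrite (kb_vol K x t0) inver gt_eqF// lee_fin invr_ge0 ltW.
by apply: ereal_inf_lbound; exists z.
Unshelve. all: by end_near. Qed.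

(** The packed volume is allowed to reach kp V(x,t), where kp is chosen to
    make [Pr_revisit] applicable, and there are n observations with n the
    integer part of V(x,t). *)
Lemma sausage_laplace_decay x (eps nu c2 : R) (q : nat -> X) :
  0 < eps -> 0 < nu -> 0 < c2 ->
  (forall (dl : R) y, 0 < dl -> exists i, mdist (q i) y < dl) ->
  exists2 g, 0 < g & exists2 M, 1 <= M & forall t, 1 <= t -> M <= V x t ->
    (forall z, ball x (t `^ beta * V x t) z -> c2 * V x t <= V z t) ->
    (sausage_laplace D eps nu x (t `^ beta * V x t)
       <= (expR (- (g * V x t)))%:E)%E.
Proof.
move=> eps0 nu0 c20 hq; pose dl := eps / 2.
have dl0 : 0 < dl by rewrite divr_gt0.
have epsE : eps = 2 * dl by rewrite /dl; field.
have [c0 C0] := (kb_c K, kb_C K).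
have d30 := doubling_const_gt0 K 3; have K0 := tail_const_gt0 K.
set k3 := doubling_const beta c C 3 in d30; set Kt := tail_const beta c C in K0.
pose kp := c2 / (2 * C * k3).
have kp0 : 0 < kp.
  by apply: divr_gt0 => //; apply: mulr_gt0 d30; exact: mulr_gt0.
pose th := expR (- (nu * (c1 * dl))).
have th0 : 0 < th by exact: expR_gt0.
have th1 : th < 1.
  by rewrite -expR0 ltr_expR oppr_lt0 !mulr_gt0// (kb_c1 K).
pose rho := (1 + th) / 2.
have rho0 : 0 < rho by rewrite divr_gt0// addr_gt0.
have rho1 : rho < 1 by rewrite ltr_pdivrMr//; lra.
(* The decay rate contributed by the new sites, per observation. *)
pose a := - ln rho.
have a0 : 0 < a by rewrite oppr_gt0 ln_lt0// rho0.
pose g := Num.min (c / 4) (Num.min (nu * kp) a).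
have g0 : 0 < g by rewrite !lt_min divr_gt0// mulr_gt0.
have [gc [gk ga]] : g <= c / 4 /\ g <= nu * kp /\ g <= a.
  by split; [|split]; rewrite /g !ge_min lexx ?orbT.
pose B := Kt * (4 / c) + 1 + expR a.
have B0 : 0 < B by rewrite !addr_gt0 ?expR_gt0// mulr_gt0// divr_gt0.
have g20 : 0 < g / 2 by rewrite divr_gt0.
have [M M1 hM] := expR_small B0 g20 ltr01.
exists (g / 2) => //; exists M => // t t1 MV near_c2.
set v := V x t in MV near_c2 *; have t0 : 0 < t by exact: lt_le_trans t1.
have v1 : 1 <= v by exact: le_trans MV.
have v0 : 0 < v by exact: lt_le_trans v1.
have tb0 : 0 < t `^ beta by rewrite powR_gt0.
set T := t `^ beta * v.
have T0 : 0 < T by rewrite mulr_gt0.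
have vT : v <= T.
  by rewrite ler_peMl ?(ltW v0)// -[1](powRr0 t); apply: ler_powR => //; exact: ltW.
pose n := Num.truncn v.
have /andP[nl nr] := truncn_itv (ltW v0).
have nT : n%:R * t `^ beta <= T by rewrite /T mulrC ler_wpM2l// ltW.
have spread z : ball x T z -> C * (k3 * (kp * v)) <= V z t / 2.
  move=> /near_c2 cz; rewrite (_ : C * _ = c2 * v / 2); last first.
    by rewrite /kp; field; rewrite (gt_eqF C0) (gt_eqF d30).
  by rewrite ler_pM2r.
have main := sausage_laplace_le D K dl0 (fun y => hq dl y dl0) t0 spread nu0 T0 nT.
rewrite epsE; apply: le_trans main _.
rewrite lee_fin -/th -/rho -/Kt.
have eg b : g <= b -> expR (- (b * v)) <= expR (- (g * v)).
  by move=> gb; rewrite ler_expR lerN2 ler_wpM2r// ltW.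
have p1 : n%:R * (Kt * expR (- (c / 2 * T))) <= Kt * (4 / c) * expR (- (g * v)).
  have c4 : 0 < c / 4 by rewrite divr_gt0.
  pose e := expR (- (c / 4 * v)); have e0 : 0 < e by exact: expR_gt0.
  have e1 : expR (- (c / 2 * T)) <= e * e.
    rewrite -expRD ler_expR -opprD lerN2 -mulrDl (_ : c / 4 + c / 4 = c / 2).
      by apply: ler_wpM2l vT; apply: ltW; exact: divr_gt0.
    by field.
  have ve : v * e <= 4 / c.
    rewrite /e expRN ler_pdivrMr ?expR_gt0// -invf_div ler_pdivlMl//.
    by apply: le_trans (expR_ge1Dx _); rewrite lerDr.
  have ge : e <= expR (- (g * v)) by exact: eg.
  rewrite mulrCA -[leRHS]mulrA; apply: ler_wpM2l; first exact: ltW.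
  apply: le_trans (ler_pM (ler0n R n) (expR_ge0 _) nl e1) _.
  rewrite mulrA; apply: ler_pM ge => //; last exact: ltW.
  by apply: mulr_ge0; exact: ltW.
have p2 : expR (- (nu * (kp * v))) <= expR (- (g * v)) by rewrite mulrA eg.
have p3 : rho ^+ n <= expR a * expR (- (g * v)).
  apply: (@le_trans _ _ (expR a * expR (- (a * v)))); last first.
    by apply: ler_wpM2l; [exact: expR_ge0 | exact: eg].
  have -> : rho = expR (- a) by rewrite /a opprK lnK.
  rewrite -expRM_natl -expRD ler_expR mulrN lerNl opprB lerBlDr.
  have := ler_wpM2l (ltW a0) (ltW nr).
  by rewrite -natr1 mulrDr mulr1 (mulrC a n%:R).
apply: (@le_trans _ _ (B * expR (- (g * v)))).
  rewrite (_ : B * _ = Kt * (4 / c) * expR (- (g * v)) + expR (- (g * v))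
    + expR a * expR (- (g * v))); last by rewrite /B; ring.
  exact: lerD (lerD p1 p2) p3.
have -> : - (g * v) = - (g / 2 * v) + - (g / 2 * v) by lra.
rewrite expRD mulrA -[leRHS]mul1r ler_wpM2r ?expR_ge0//.
exact: hM.
Qed.

End bounds.

Theorem theorem1 (R : realType) (X : completeMetricType R)
    (mu : {measure set (borel X) -> \bar R})
    (E : dirichlet_form mu) (H : heat_semigroup E) (h : R -> X -> X -> R)
    (d : measure_display) (W : measurableType d) (D : diffusion mu h W)
    (beta : R)
    (X_lc : locally_compact [set: X]) (X_sep : separable X)
    (mu_radon : radon mu) (mu_sfin : sigma_finite [set: borel X] mu)
    (E_reg : regular_form E) (E_loc : strongly_local E)
    (h_kernel : heat_kernel H h)
    (beta12 : 1 < beta <= 2)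
    (hV1 : V1 mu) (hV2 : V2 mu beta) (hGE : GE mu beta h) :
  forall (eps nu : R) (x : X), 0 < eps -> 0 < nu ->
    exists c C : R, [/\ 0 < c, c <= C &
      \forall t \near +oo,
        let L := (- lne (sausage_laplace D eps nu x
                           (t `^ beta * fine (vol mu x t))%R))%E in
        (c%:E * vol mu x t <= L)%E /\ (L <= C%:E * vol mu x t)%E].
Proof.
move=> eps nu x eps0 nu0; have /andP[b1 _] := beta12.
have h_meas t : 0 < t ->
    measurable_fun setT (fun z : borel X * borel X => h t z.1 z.2).
  by move=> /h_kernel[].
have [c [C [c1 K]]] := kernel_bounds_of_GE b1 h_meas hV1 hGE.
have [q hq] := separable_seq x X_sep.
have [c2 c20 near_c2] := volume_lower_of_V2 K x hV2.
have [g g0 [M M1 up]] := sausage_laplace_decay D K x eps0 nu0 c20 hq.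
have [C2 C20 lo] := sausage_laplace_ge D K x eps0 nu0.
exists (Num.min g C2), C2; split; [by rewrite lt_min g0 | by rewrite ge_min lexx orbT |].
have c10 := kb_c1 K.
near=> t; cbv zeta.
have t1 : 1 <= t by near: t; exact: (nbhs_pinfty_ge (num_real _)).
have t0 : 0 < t by exact: lt_le_trans t1.
have te : eps <= t by near: t; exact: (nbhs_pinfty_ge (num_real _)).
have VM : M <= fine (vol mu x t).
  by apply: le_trans (kb_lin K x t0); rewrite -ler_pdivrMl //.
have v1 := le_trans M1 VM.
have {}up : (sausage_laplace D eps nu x (t `^ beta * fine (vol mu x t))
    <= (expR (- (g * fine (vol mu x t))))%:E)%E by apply: up => //; near: t.
have {}lo := lo t te v1.
rewrite (kb_vol K x t0) -!EFinM; set S := sausage_laplace _ _ _ _ _ in up lo *.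
have S0 : (0 <= S)%E by apply: integral_ge0 => w _; exact: expeR_ge0.
have lneE (a : R) : lne (expR (- a))%:E = (- a)%:E by rewrite lne_EFin ?expR_gt0// expRK.
have Sin : S \in `[0, +oo]%E by rewrite in_itv /= S0 leey.
have Ein (a : R) : (expR a)%:E \in `[0, +oo]%E by rewrite in_itv /= lee_fin expR_ge0 leey.
split.
  rewrite leeNr; apply: (@le_trans _ _ (lne (expR (- (g * fine (vol mu x t))))%:E)).
    rewrite lee_lne; [exact: up | exact: Sin | exact: Ein].
  rewrite lneE -EFinN lee_fin lerN2 ler_wpM2r ?ge_min ?lexx//.
  by rewrite (le_trans _ v1).
by rewrite leeNl -EFinN -lneE lee_lne.
Unshelve. all: by end_near. Qed.
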